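(* Let $d\in\mathbb N$ and $p\in[0,1]$. Then $$\lambda_d(p)\ \ge\ \tfrac12\bigl(-p\log p-2(1-p)\log(1-p)+p\log 2d-p\bigr).$$ Furthermore $$\tilde h_d=\lambda_d(1)\ \ge\ \tfrac12\bigl((2d-1)\log(2d-1)-(2d-2)\log 2d\bigr),$$ $$h_d\ \ge\ \tfrac12\bigl(-p(d)\log p(d)-2(1-p(d))\log(1-p(d))+p(d)\log 2d-p(d)\bigr),\quad\text{where } p(d)=\frac{4d+1-\sqrt{8d+1}}{4d}.$$
   Context: Convention $0\log 0=0$. Notation: $\langle\mathbf m\rangle=\{1,\dots,m_1\}\times\cdots\times\{1,\dots,m_d\}$, $|\mathbf m|_{\mathrm{pr}}=m_1\cdots m_d$, $\mathbf e_k$ unit vectors. Monomer-dimer covers are encoded by colors $\{1,\dots,2d+1\}$ and $\Gamma=(\Gamma_1,\dots,\Gamma_d)$: $(k,q)\in\Gamma_k\iff q=k+d$, and for $j\ne k$, $(j,q)\in\Gamma_k\iff q\ne k+d$. $W(\mathbf m)$: maps $\phi:\langle\mathbf m\rangle\to\{1,\dots,2d+1\}$ with $(\phi_{\mathbf i},\phi_{\mathbf i+\mathbf e_k})\in\Gamma_k$ whenever both points lie in $\langle\mathbf m\rangle$. $W_0(\mathbf m)$: those $\phi\in W(\mathbf m)$ with no $\mathbf i$ having $\phi_{\mathbf i}=k$, $i_k=m_k$, and no $\mathbf i$ having $\phi_{\mathbf i}=k+d$, $i_k=1$ (tilings of the box); $W_0(\mathbf m,s)$: those with exactly $s$ dimers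 (exactly $s$ points colored in $\{1,\dots,d\}$). $\widetilde W(\mathbf m)$: as $W(\mathbf m)$ but with colors in $\{1,\dots,2d\}$. $h_d=\lim_{\mathbf m\to\infty}\log\#W(\mathbf m)/|\mathbf m|_{\mathrm{pr}}$, $\tilde h_d=\lim_{\mathbf m\to\infty}\log\#\widetilde W(\mathbf m)/|\mathbf m|_{\mathrm{pr}}$. It is known (Hammersley) that there is a continuous concave function $\lambda_d:[0,1]\to\mathbb R_+$ such that whenever $\mathbf m_q\to\infty$ (all coordinates), $s_q\in[0,|\mathbf m_q|_{\mathrm{pr}}/2]\cap\mathbb Z$ and $2s_q/|\mathbf m_q|_{\mathrm{pr}}\to p$, we have $\log\#W_0(\mathbf m_q,s_q)/|\mathbf m_q|_{\mathrm{pr}}\to\lambda_d(p)$; and (as shown in the paper) $\lambda_d(1)=\tilde h_d$. *)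

(* Defs.v *)
From HB Require Import structures.
From mathcomp Require Import all_boot all_order all_algebra.
From mathcomp Require Import all_classical all_reals all_analysis.

Set Implicit Arguments.
Unset Strict Implicit.
Unset Printing Implicit Defensive.

Import Order.TTheory GRing.Theory Num.Theory.
Import numFieldNormedType.Exports.

(* Everything that is 1-based in the mathematics is 0-based here: the
   directions are k : 'I_d, the points of the box m have coordinates
   i k < m k, and the color usually called c is (c - 1) : 'I_n.  So the colors
   k and k + d (k < d) are the two ends of a dimer in direction k, and the
   color 2d, present only when n = 2d + 1, is the monomer. *)

Definition box (d : nat) (m : 'I_d -> nat) : finType :=
  {dffun forall k : 'I_d, 'I_(m k)}.

Definition volume (d : nat) (m : 'I_d -> nat) : nat := (\prod_(k < d) m k)%N.

(* j = i + e_k *)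
Definition next_in (d : nat) (m : 'I_d -> nat) (k : 'I_d) (i j : box m) : bool :=
  [forall l : 'I_d, (j l == i l + (l == k) :> nat)%N].

Definition Gamma (d n : nat) (k : 'I_d) (p q : 'I_n) : bool :=
  if (p == k :> nat)%N then (q == k + d :> nat)%N else (q != k + d :> nat)%N.

Definition coloring (d n : nat) (m : 'I_d -> nat) : finType :=
  {ffun box m -> 'I_n}.

(* The admissible colorings of the box m by n colors: dimers may protrude from
   the box. *)
Definition admissible (d n : nat) (m : 'I_d -> nat) : {set coloring n m} :=
  [set phi : coloring n m |
    [forall k : 'I_d, forall i : box m, forall j : box m,
      next_in k i j ==> Gamma k (phi i) (phi j)]].

Definition covers (d : nat) (m : 'I_d -> nat) : {set coloring (2 * d).+1 m} :=
  admissible (2 * d).+1 m.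

Definition dimer_covers (d : nat) (m : 'I_d -> nat) : {set coloring (2 * d) m} :=
  admissible (2 * d) m.

Definition tilings (d : nat) (m : 'I_d -> nat) : {set coloring (2 * d).+1 m} :=
  [set phi in covers m |
    [forall k : 'I_d, forall i : box m,
      ~~ ((phi i == k :> nat) && ((i k).+1 == m k))%N &&
      ~~ ((phi i == k + d :> nat) && (i k == 0 :> nat))%N]].

Definition tilings_with (d : nat) (m : 'I_d -> nat) (s : nat) :
    {set coloring (2 * d).+1 m} :=
  [set phi in tilings m | #|[pred i : box m | (phi i < d)%N]| == s].

Local Open Scope classical_set_scope.
Local Open Scope ring_scope.

(* The filter "m tends to infinity in every coordinate" *)
Definition boxes_oo (d : nat) : set_system ('I_d -> nat) :=
  [set P | exists N : nat,
     forall m : 'I_d -> nat, (forall k, (N <= m k)%N) -> P m].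
Arguments boxes_oo d : clear implicits.

Global Instance boxes_oo_filter (d : nat) : ProperFilter (boxes_oo d).
Proof.
split.
  by case=> N /(_ (fun=> N)); apply => k.
split.
- by exists 0%N.
- move=> P Q [M hM] [N hN]; exists (maxn M N) => m hm.
  split; [apply: hM | apply: hN] => k;
    by apply: leq_trans (hm k); rewrite ?leq_maxl ?leq_maxr.
- by move=> P Q PQ [N hN]; exists N => m hm; apply: PQ; exact: hN.
Qed.

Definition log_density (R : realType) (d : nat) (m : 'I_d -> nat) (N : nat) : R :=
  ln N%:R / (volume m)%:R.

Definition monomer_dimer_entropy (R : realType) (d : nat) (h : R) : Prop :=
  log_density R m #|covers m| @[m --> boxes_oo d] --> h.

Definition dimer_entropy (R : realType) (d : nat) (h : R) : Prop :=
  log_density R m #|dimer_covers m| @[m --> boxes_oo d] --> h.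

(* The properties of Hammersley's function p |-> lambda_d(p); the last one
   determines it on [0, 1], and its values outside [0, 1] are irrelevant. *)
Record hammersley_function (R : realType) (d : nat) (lambda : R -> R) : Prop := {
  hammersley_continuous : {within `[0, 1], continuous lambda} ;
  hammersley_concave :
    @convex_function R R^o `[0, 1]%classic (fun x => - lambda x) ;
  hammersley_ge0 : forall p : R, 0 <= p <= 1 -> 0 <= lambda p ;
  hammersley_cvg : forall (p : R) (m : nat -> 'I_d -> nat) (s : nat -> nat),
    0 <= p <= 1 ->
    m @ \oo --> boxes_oo d ->
    (forall q, (2 * s q <= volume (m q))%N) ->
    (2 * s q)%:R / (volume (m q))%:R @[q --> \oo] --> p ->
    log_density R (m q) #|tilings_with (m q) (s q)| @[q --> \oo] --> lambda p }.

(* Main.v *)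
(* The s-dimer tilings of a box are the s-edge matchings of a bipartite graph
   that is 2d-regular away from its boundary.  Its monomer-dimer partition
   function Z(w) is bounded below as in Gurvits' proof of the Schrijver and van
   der Waerden inequalities: attach a variable x_j to every cell j of one color
   class, and eliminate the cells j one at a time, controlling the exponent of
   each remaining variable.  Stability of polynomials is not needed: the only
   input is that monomers on cells of one color class are negatively
   correlated, which bounds the polynomial in the variable being eliminated by
   a product of linear factors.  The result is, for every density theta,
     ln Z(w) / volume >= (G(theta) + theta ln w) / 2 - o(1),
   where G is the Bethe entropy of the 2d-regular tree.  Since lambda is
   concave, choosing w from a supporting line of lambda at theta turns this into
   lambda(theta) >= G(theta) / 2, and the stated bounds are elementary
   consequences.  Finally ht = lambda 1 because turning the protruding halves of
   dimers into monomers changes only boundary cells. *)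

Require Import Defs.
From HB Require Import structures.
From mathcomp Require Import all_boot all_order all_algebra.
From mathcomp Require Import all_classical all_reals all_analysis.
From mathcomp Require Import zify ring lra.
Import Order.TTheory GRing.Theory Num.Theory.
Import numFieldNormedType.Exports.
Local Open Scope ring_scope.

Set Implicit Arguments.
Unset Strict Implicit.
Unset Printing Implicit Defensive.

(** * Entropy bounds for logarithms of affine forms *)

Section EntropyInequalities.
Variable R : realType.
Implicit Types (I : finType) (w y : R).

Lemma ln_le_subr1 (x : R) : 0 < x -> ln x <= x - 1.
Proof.
move=> x0; have := @le_ln1Dx R (x - 1).
by rewrite (_ : 1 + (x - 1) = x); [apply; lra | ring].
Qed.

(* Gibbs' inequality for the weights [y] (each [i]) and [1 - #|P| y]. *)
Lemma ln_affine_ge I (P : pred I) w y r (x : I -> R) :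
  0 < w -> 0 < y -> r = #|P|%:R * y -> r < 1 -> (forall i, P i -> 0 < x i) ->
  - (1 - r) * ln (1 - r) + r * ln (w / y) + y * \sum_(i | P i) ln (x i)
    <= ln (1 + w * \sum_(i | P i) x i).
Proof.
move=> w0 y0 rE r1 x0; set Q := 1 + w * _.
have Q0 : 0 < Q.
  suff : 0 <= w * \sum_(i | P i) x i by rewrite /Q; lra.
  by rewrite mulr_ge0 ?(ltW w0)// sumr_ge0// => i /x0/ltW.
have le_mono : (1 - r) * ln (Q^-1 / (1 - r)) <= Q^-1 - (1 - r).
  have r0 : 0 < 1 - r by lra.
  have -> : Q^-1 - (1 - r) = (1 - r) * (Q^-1 / (1 - r) - 1) by field; lra.
  by rewrite ler_pM2l // ln_le_subr1// divr_gt0 ?invr_gt0.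
have le_dimer i : P i -> y * ln (w * x i / Q / y) <= w * x i / Q - y.
  move=> /x0 xi; have -> : w * x i / Q - y = y * (w * x i / Q / y - 1).
    by field; rewrite ?gt_eqF.
  by rewrite ler_pM2l // ln_le_subr1// !divr_gt0 ?mulr_gt0.
have := lerD le_mono (ler_sum (index_enum I) le_dimer).
have -> : \sum_(i | P i) (w * x i / Q - y) = (Q - 1) / Q - r.
  rewrite sumrB sumr_const -mulr_suml -mulr_sumr /Q addrAC subrr add0r.
  by rewrite rE mulr_natl.
(* Both [Q^-1] with the [w * x i / Q], and [1 - r] with the copies of [y], have total mass [1], so
   the upper bounds cancel. *)
have -> : Q^-1 - (1 - r) + ((Q - 1) / Q - r) = 0 by field; rewrite gt_eqF.
have -> : \sum_(i | P i) y * ln (w * x i / Q / y) =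
   \sum_(i | P i) (y * ln (x i) + y * (ln (w / y) - ln Q)).
  apply: eq_bigr => i /x0 xi; rewrite -mulrDr; congr (_ * _).
  rewrite -ln_div ?posrE ?divr_gt0// -lnM ?posrE ?divr_gt0//.
  by congr ln; field; rewrite ?gt_eqF.
rewrite big_split /= sumr_const -mulr_sumr -[_ *+ _]mulr_natl mulrA -rE.
rewrite [ln (Q^-1 / _)]lnM ?posrE ?invr_gt0 ?subr_gt0//.
rewrite !(lnV (x := Q), lnV (x := 1 - r)) ?posrE ?subr_gt0//.
lra.
Qed.

(* Taking [t] with [t * \sum v = #|P| * s], [s := y / (1 - y)], makes the
   hypothesis optimal. *)
Lemma ln_derivative_ge I (P : pred I) y r (v : I -> R) (a K : R) :
  0 < y < 1 -> r = #|P|%:R * y -> r < 1 -> (forall i, P i -> 0 < v i) ->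
  (forall t, 0 < t -> K + r * ln t <= a + \sum_(i | P i) ln (1 + t * v i)) ->
  K - (1 - r) * ln (1 - r) + #|P|%:R * (1 - y) * ln (1 - y)
    <= a + ln (1 + \sum_(i | P i) v i).
Proof.
move=> /andP[y0 y1] rE r1 v0 le_K.
have [P0|Pn0] := eqVneq #|P| 0%N.
  have noP i : P i = false by rewrite -[P i]/(i \in P) (card0_eq P0).
  have := le_K 1 ltr01; rewrite rE P0 !mul0r !big_pred0//.
  by rewrite !(subr0, addr0, ln1, mulr0).
have kap0 : 0 < #|P|%:R :> R by rewrite ltr0n lt0n.
set kap : R := #|P|%:R in rE kap0 *; set u := \sum_(i | P i) v i.
have r0 : 0 < r by rewrite rE mulr_gt0.
have u0 : 0 < u.
  have /card_gt0P[i0 Pi0] : (0 < #|P|)%N by rewrite lt0n.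
  rewrite /u (bigD1 i0) //= ltr_wpDr ?v0// sumr_ge0// => i /andP[/v0/ltW//].
pose s := y / (1 - y).
have s0 : 0 < s by rewrite /s divr_gt0 ?subr_gt0.
have t0 : 0 < kap * s / u by apply: divr_gt0 => //; apply: mulr_gt0.
have := le_K _ t0; set t := kap * s / u in t0 *.
have le_sum : \sum_(i | P i) ln (1 + t * v i) <= - kap * ln (1 - y).
  (* The logarithm lies below its tangent at [t * v i = s], where [1 + s = 1 / (1 - y)]. By the
     choice of [t] the linear parts sum to zero. *)
  have le1 i : P i -> ln (1 + t * v i) <= (1 - y) * (t * v i - s) - ln (1 - y).
    move=> /v0 vi; have y1' : 0 < 1 - y by lra.
    have q0 : 0 < (1 - y) * (1 + t * v i).
      by apply: mulr_gt0 => //; apply: addr_gt0 => //; apply: mulr_gt0.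
    have q1 : 0 < 1 + t * v i by rewrite pmulr_rgt0 in q0.
    have := ln_le_subr1 q0; rewrite lnM ?posrE//.
    have -> : (1 - y) * (t * v i - s) = (1 - y) * (1 + t * v i) - 1.
      by rewrite /s; field; lra.
    lra.
  apply: (le_trans (ler_sum _ le1)).
  rewrite sumrB -mulr_sumr sumrB -mulr_sumr -/u !sumr_const.
  rewrite -[s *+ _]mulr_natl -[ln _ *+ _]mulr_natl -/kap.
  by rewrite /t divfK ?gt_eqF// subrr mulr0 sub0r mulNr.
(* Gibbs' inequality with a single term bounds [ln (1 + u)] below by a multiple of [ln u], with
   coefficient [r]; this [ln u] cancels the one in [r * ln t]. *)
have := @ln_affine_ge unit predT 1 r r (fun=> u) ltr01 r0.
move=> /(_ _ _ (fun _ _ => u0)).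
rewrite card_unit !mul1r => /(_ erefl r1) /=.
rewrite (_ : \sum_i _ = ln u); last by rewrite (bigD1 tt) //= big_pred0 ?addr0// => -[].
rewrite (_ : \sum_i _ = u); last by rewrite (bigD1 tt) //= big_pred0 ?addr0// => -[].
have -> : ln t = ln r - ln (1 - y) - ln u.
  rewrite -!ln_div ?posrE ?divr_gt0 ?subr_gt0//; congr ln.
  by rewrite /t /s rE; field; rewrite ?gt_eqF//; lra.
rewrite lnV ?posrE//.
set A := ln (1 - r); set B := ln (1 - y); set C := ln u; set D := ln r.
have -> : kap * (1 - y) * B = kap * B - r * B by rewrite rE; ring.
by move=> h1 h2; rewrite -/B in le_sum; lra.
Qed.
End EntropyInequalities.

(* [Z alpha A] stands for the sum over the matchings of the graph induced on [A],
   with weight [alpha v] for an unmatched [v] and [w] for an edge. *)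
Record monomer_dimer_recursion (R : realType) (V : finType) (e : rel V) (w : R)
    (Z : (V -> R) -> {set V} -> R) : Prop := {
  mdr_set0 : forall alpha, Z alpha finset.set0 = 1 ;
  mdr_rec : forall alpha (A : {set V}) a, a \in A ->
    Z alpha A = alpha a * Z alpha (A :\ a)
      + w * \sum_(c in A :\ a | e a c) Z alpha (A :\ a :\ c) }.

(** * Monomer correlations in matchings of a bipartite graph *)

Section MonomerDimer.
Variables (R : realType) (V : finType) (e : rel V) (side : V -> bool) (w : R).
Variable Z : (V -> R) -> {set V} -> R.
Hypothesis e_side : forall a c, e a c -> side a != side c.
Hypothesis w_gt0 : 0 < w.
Hypothesis ZP : monomer_dimer_recursion e w Z.

Lemma Z_gt0 alpha (A : {set V}) : (forall a, 0 < alpha a) -> 0 < Z alpha A.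
Proof.
move=> alpha0; have [n] := ubnP #|A|; elim: n A => // n IH A ltAn.
case: (finset.set_0Vmem A) => [->|[a aA]]; first by rewrite (mdr_set0 ZP).
have ltA1 (B : {set V}) : B \subset A :\ a -> (#|B| < n)%N.
  by move=> /subset_leq_card leB; rewrite (cardsD1 a) aA in ltAn; lia.
rewrite (mdr_rec ZP _ aA) ltr_wpDr ?mulr_gt0 ?IH ?ltA1 //.
by rewrite mulr_ge0 ?sumr_ge0 ?ltW// => c _; rewrite ltW ?IH ?ltA1 ?finset.subD1set.
Qed.

Lemma eq_Z alpha beta (A : {set V}) : {in A, alpha =1 beta} -> Z alpha A = Z beta A.
Proof.
have [n] := ubnP #|A|; elim: n A => // n IH A ltAn eqA.
case: (finset.set_0Vmem A) => [->|[a aA]]; first by rewrite !(mdr_set0 ZP).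
have ZB (B : {set V}) : B \subset A :\ a -> Z alpha B = Z beta B.
  move=> sBA; apply: IH => [|x xB].
    by move/subset_leq_card: sBA; rewrite (cardsD1 a) aA in ltAn; lia.
  by apply: eqA; case/finset.setD1P: (fintype.subsetP sBA _ xB).
rewrite !(mdr_rec ZP _ aA) eqA// ZB//; congr (_ + _ * _).
by apply: eq_bigr => c _; rewrite ZB ?finset.subD1set.
Qed.

Lemma setD1C (A : {set V}) a b : A :\ a :\ b = A :\ b :\ a.
Proof. by rewrite !finset.setDDl finset.setUC. Qed.

(* The two inequalities feed each other: expanding at [a], each one for [A]
   reduces termwise to the other one for [A :\ a]. *)
Lemma monomer_correlation alpha (A : {set V}) a b : (forall v, 0 < alpha v) ->
  a \in A -> b \in A -> a != b ->
  if side a == side b then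
    Z alpha A * Z alpha (A :\ a :\ b) <= Z alpha (A :\ a) * Z alpha (A :\ b)
  else
    Z alpha (A :\ a) * Z alpha (A :\ b) <= Z alpha A * Z alpha (A :\ a :\ b).
Proof.
move=> alpha0.
have [n] := ubnP #|A|; elim: n A a b => // n IH A a b ltAn aA bA neq_ab.
have bAa : b \in A :\ a by rewrite !inE eq_sym neq_ab.
have aAb : a \in A :\ b by rewrite !inE neq_ab.
have ltAa : (#|A :\ a| < n)%N by rewrite (cardsD1 a) aA in ltAn.
have Z0 := fun B => Z_gt0 B alpha0.
rewrite (mdr_rec ZP _ aA) (mdr_rec ZP _ aAb) (setD1C _ b a).
set S := \sum_(c in A :\ a | _) _; set T := \sum_(c in A :\ a :\ b | _) _.
case: eqP => [sab|/eqP sab].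
- suff le_ST : S * Z alpha (A :\ a :\ b) <= Z alpha (A :\ a) * T.
    by move: (ler_wpM2l (ltW w_gt0) le_ST); set P := Z _ (_ :\ _ :\ _); lra.
  rewrite mulr_suml mulr_sumr /S /T.
  rewrite [leLHS]big_mkcond [leRHS]big_mkcond /=; apply: ler_sum => c _.
  have [->|neq_cb] := eqVneq c b.
    case: (boolP (e a b)) => [/e_side|_]; first by rewrite sab eqxx.
    by rewrite !andbF.
  rewrite [c \in A :\ a :\ b]in_setD1 neq_cb /=; case: ifP => // /andP[cAa eac].
  have := IH _ _ _ ltAa bAa cAa; rewrite eq_sym neq_cb => /(_ isT).
  rewrite -sab; move/negPf: (e_side eac) => ->.
  by rewrite [leLHS]mulrC.
- suff le_ST : Z alpha (A :\ a) * T <= S * Z alpha (A :\ a :\ b).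
    by move: (ler_wpM2l (ltW w_gt0) le_ST); set P := Z _ (_ :\ _ :\ _); lra.
  rewrite mulr_suml mulr_sumr /S /T.
  rewrite [leLHS]big_mkcond [leRHS]big_mkcond /=; apply: ler_sum => c _.
  (* The term [c = b] can occur only in [S], on the larger side, where it is nonnegative. *)
  have [->|neq_cb] := eqVneq c b.
    rewrite !inE eqxx /=; case: ifP => // _.
    by rewrite mulr_ge0 // ltW.
  rewrite [c \in A :\ a :\ b]in_setD1 neq_cb /=; case: ifP => // /andP[cAa eac].
  have := IH _ _ _ ltAa bAa cAa; rewrite eq_sym neq_cb => /(_ isT).
  have -> : side b == side c.
    by move: (e_side eac) sab; case: (side a) (side b) (side c) => [] [] [].
  by rewrite [leRHS]mulrC.
Qed.

(** Giving the value [t] to the variable of a cell raises the weights of its neighbors by [w * t].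
    The list allows raising them one at a time. *)
Definition bump (alpha : V -> R) (delta : R) (s : seq V) (v : V) : R :=
  alpha v + (if v \in s then delta else 0).

Lemma bump_gt0 alpha delta s : 0 <= delta -> (forall v, 0 < alpha v) ->
  forall v, 0 < bump alpha delta s v.
Proof. by move=> d0 alpha0 v; rewrite /bump ltr_wpDr//; case: ifP. Qed.

Lemma Z_bump_cons alpha delta x s (A : {set V}) : x \notin s -> x \in A ->
  Z (bump alpha delta (x :: s)) A =
    Z (bump alpha delta s) A + delta * Z (bump alpha delta s) (A :\ x).
Proof.
move=> xs xA; rewrite !(mdr_rec ZP _ xA).
have ZE (B : {set V}) : B \subset A :\ x ->
    Z (bump alpha delta (x :: s)) B = Z (bump alpha delta s) B.
  move=> sB; apply: eq_Z => v vB; rewrite /bump inE.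
  by case/finset.setD1P: (fintype.subsetP sB _ vB) => /negPf ->.
rewrite ZE// /bump inE eqxx (negPf xs) addr0 mulrDl -!addrA; congr (_ + _).
rewrite addrC; congr (_ * _ + _).
by apply: eq_bigr => c _; rewrite ZE ?finset.subD1set.
Qed.

Section SameSide.
Variables (alpha : V -> R) (delta : R) (A : {set V}) (b : bool).
Hypothesis alpha0 : forall v, 0 < alpha v.
Hypothesis delta0 : 0 <= delta.

Let bump0 s : forall v, 0 < bump alpha delta s v := bump_gt0 s delta0 alpha0.

(** In cross-multiplied form: raising weights on the side of [i] cannot increase the ratio
    [Z (A :\ i) / Z A], because monomers on one side are negatively correlated. *)
Lemma Z_bump_ratio s i : uniq s -> {subset s <= A} ->
    {in s, forall v, side v = b} -> i \in A -> side i = b -> i \notin s ->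
  Z (bump alpha delta s) (A :\ i) * Z alpha A
    <= Z alpha (A :\ i) * Z (bump alpha delta s) A.
Proof.
elim: s => [|x s IH] /=.
  move=> _ _ _ _ _ _.
  by rewrite !(@eq_Z _ alpha) => [|v _|v _]; rewrite /bump ?addr0.
move=> /andP[xs us] sA sb iA ib; rewrite inE negb_or => /andP[neq_ix is_].
have xA : x \in A by apply: sA; rewrite mem_head.
have sA' : {subset s <= A} by move=> v vs; apply: sA; rewrite inE vs orbT.
have sb' : {in s, forall v, side v = b}.
  by move=> v vs; apply: sb; rewrite inE vs orbT.
have xAi : x \in A :\ i by rewrite !inE eq_sym neq_ix.
rewrite !Z_bump_cons//.
have := monomer_correlation (bump0 s) iA xA neq_ix.
rewrite ib (sb x (mem_head _ _)) eqxx => nc.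
have ih := IH us sA' sb' iA ib is_.
set z := Z (bump alpha delta s) in nc ih *.
have z0 : 0 < z A by exact: Z_gt0.
(* Inserting the factor [z A] lets the correlation inequality and the induction hypothesis be
   chained through [z (A :\ i) * z (A :\ x)]. *)
rewrite mulrDl mulrDr lerD// mulrCA -!mulrA ler_wpM2l// -(ler_pM2l z0).
have h1 := ler_wpM2r (ltW (Z_gt0 A alpha0)) nc.
have h2 := ler_wpM2r (ltW (Z_gt0 (A :\ x) (bump0 s))) ih.
rewrite -/z in h2; lra.
Qed.

(** Raising the weight at one cell [x] multiplies [Z] by [1 + delta] times the current ratio at [x],
    and by [Z_bump_ratio] this ratio is at most its value before any weight was raised. *)
Lemma Z_bump_le s : uniq s -> {subset s <= A} ->
    {in s, forall v, side v = b} ->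
  Z (bump alpha delta s) A
    <= Z alpha A * \prod_(i <- s) (1 + delta * (Z alpha (A :\ i) / Z alpha A)).
Proof.
elim: s => [|x s IH] /=.
  by rewrite big_nil mulr1 (@eq_Z _ alpha) => // v _; rewrite /bump addr0.
move=> /andP[xs us] sA sb.
have xA : x \in A by apply: sA; rewrite mem_head.
have sA' : {subset s <= A} by move=> v vs; apply: sA; rewrite inE vs orbT.
have sb' : {in s, forall v, side v = b}.
  by move=> v vs; apply: sb; rewrite inE vs orbT.
rewrite Z_bump_cons// big_cons.
have ratio := Z_bump_ratio us sA' sb' xA (sb _ (mem_head _ _)) xs.
have a0 := Z_gt0 A alpha0; have z0 := Z_gt0 A (bump0 s).
rewrite mulrCA; apply: le_trans (ler_wpM2l _ (IH us sA' sb')); last first.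
  by rewrite addr_ge0// mulr_ge0// divr_ge0// ltW// Z_gt0.
rewrite mulrDl mul1r lerD// -mulrA ler_wpM2l// mulrAC ler_pdivlMr//.
Qed.

End SameSide.

(** * Elimination of the variables of one color class *)

Section Capacity.
Local Notation columns := (finset.finset side).
Variable y : R.
Hypothesis e_sym : symmetric e.
Hypothesis y01 : 0 < y < 1.
Hypothesis deg_lt : forall v, #|e v|%:R * y < 1.

(** The constant that [ln_affine_ge] gives for the linear form of the row [v], apart from the terms
    [ln (x j)]. *)
Definition row_term v : R :=
  let r := #|e v|%:R * y in - (1 - r) * ln (1 - r) + r * ln (w / y).

(** The constant that [ln_derivative_ge] gives when the column [v] is eliminated. *)
Definition column_term v : R :=
  let r := #|e v|%:R * y in
  - (1 - r) * ln (1 - r) + #|e v|%:R * (1 - y) * ln (1 - y).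

(* [U] is the set of columns not eliminated yet. *)
Definition field_weight (U : {set V}) (x : V -> R) (v : V) : R :=
  1 + w * \sum_(j in U | e v j) x j.

(** In exponential form, a capacity bound: the polynomial in the remaining variables dominates a
    constant times the monomial with exponent [#|e j| * y] at each [x j]. *)
Definition capacity_bound (U : {set V}) : Prop :=
  forall x : V -> R, (forall v, 0 < x v) ->
    \sum_(i | ~~ side i) row_term i + \sum_(j | side j && (j \notin U)) column_term j
      + \sum_(j in U) #|e j|%:R * y * ln (x j)
    <= ln (Z (field_weight U x) (~: U)).

Lemma field_weight_gt0 U x : (forall v, 0 < x v) -> forall v, 0 < field_weight U x v.
Proof.
move=> x0 v; rewrite ltr_wpDr// mulr_ge0 ?(ltW w_gt0)// sumr_ge0// => j _.
by rewrite ltW.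
Qed.

Lemma Z_independent alpha (A : {set V}) :
  {in A &, forall a c, ~~ e a c} -> Z alpha A = \prod_(a in A) alpha a.
Proof.
have [n] := ubnP #|A|; elim: n A => // n IH A ltAn indep.
case: (finset.set_0Vmem A) => [->|[a aA]]; first by rewrite (mdr_set0 ZP) big_set0.
rewrite (mdr_rec ZP _ aA) (big_setD1 a aA) /= IH.
- rewrite [X in _ + w * X]big1 ?mulr0 ?addr0// => c /andP[/finset.setD1P[_ cA] eac].
  by have := indep _ _ aA cA; rewrite eac.
- by rewrite (cardsD1 a) aA in ltAn.
- by move=> u v /finset.setD1P[_ uA] /finset.setD1P[_ vA]; exact: indep.
Qed.

Lemma side_nbr a c : e a c -> side c = ~~ side a.
Proof. by move/e_side; case: (side a) (side c) => [] []. Qed.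

(** Before any elimination only the rows are present. They are independent, so [Z] is a product of
    affine forms, and [ln_affine_ge] applies to each factor. *)
Lemma capacity_bound_init : capacity_bound columns.
Proof.
move=> x x0; rewrite [X in _ + X + _]big1 ?addr0; last first.
  by move=> j; rewrite !inE andbN.
rewrite Z_independent; last first.
  move=> a c; rewrite !inE => /negPf sa /negPf sc; apply/negP => /side_nbr.
  by rewrite sa sc.
have lnE (s : seq V) : ln (\prod_(a <- s | a \in ~: columns) field_weight columns x a)
    = \sum_(a <- s | ~~ side a) ln (1 + w * \sum_(j | e a j) x j).
  elim: s => [|a s IHs]; first by rewrite !big_nil ln1.
  rewrite !big_cons !inE; case: (boolP (side a)) => //= sa.
  rewrite lnM ?posrE ?IHs//; last first.
  - by apply: prodr_gt0 => i _; exact: field_weight_gt0.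
  - exact: field_weight_gt0.
  congr (ln (1 + w * _) + _); apply: eq_bigl => j; rewrite inE.
  by case: (boolP (e a j)) => [/side_nbr ->|]; rewrite ?sa ?andbF.
rewrite lnE.
(* Double counting of edges: a column receives [y * ln (x j)] from each of its neighbors, all of
   which are rows. *)
have -> : \sum_(j in columns) #|e j|%:R * y * ln (x j) =
    \sum_(a | ~~ side a) y * \sum_(j | e a j) ln (x j).
  under [RHS]eq_bigr do rewrite mulr_sumr big_mkcond.
  rewrite exchange_big [LHS]big_mkcond /=; apply: eq_bigr => j _; rewrite inE.
  rewrite -big_mkcondr /=; case: ifP => sj; last first.
    rewrite big_pred0// => a; case: (boolP (e a j)) => [/side_nbr|_].
      by rewrite sj; case: (side a).
    by rewrite andbF.
  rewrite -mulrA [in LHS]mulr_natl -sumr_const; apply: eq_bigl => a.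
  rewrite -[a \in e j]/(e j a) e_sym; case: (boolP (e a j)) => [/side_nbr|].
    by rewrite sj; case: (side a).
  by rewrite andbF.
rewrite -big_split /=; apply: ler_sum => a sa.
by apply: ln_affine_ge => //; case/andP: y01.
Qed.

(** As a function of [t = x j], the polynomial for [j |: U] is at most a product of linear factors
    by [Z_bump_le]. Its value plus its derivative at [t = 0] is [Z] with the cell [j] put back, and
    [ln_derivative_ge] bounds exactly this sum. *)
Lemma capacity_bound_step (U : {set V}) j : U \subset columns ->
  side j -> j \notin U -> capacity_bound (j |: U) -> capacity_bound U.
Proof.
move=> sU sj jU capU x x0.
have jCU : j \in ~: U by rewrite inE.
have U_side v : v \in U -> side v by move/(fintype.subsetP sU); rewrite inE.
have nbrA v : e j v -> v \in ~: U :\ j.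
  move=> /side_nbr sv; rewrite !inE; apply/andP; split.
    by apply/eqP => vj; rewrite vj sj in sv.
  by apply/negP => /U_side; rewrite sv sj.
set alpha := field_weight U x; set A := ~: U :\ j in nbrA *.
have alpha0 : forall v, 0 < alpha v by exact: field_weight_gt0.
have a0 := Z_gt0 A alpha0.
pose v i := w * Z alpha (A :\ i) / Z alpha A.
have v0 i : 0 < v i by rewrite divr_gt0// mulr_gt0// Z_gt0.
have ZE : Z alpha (~: U) = Z alpha A * (1 + \sum_(i | e j i) v i).
  rewrite (mdr_rec ZP _ jCU) -/A.
  (* The neighbors of [j] are rows, so none of them is in [U]. *)
  have -> : alpha j = 1.
    rewrite /alpha /field_weight big_pred0 ?mulr0 ?addr0// => i.
    by apply/negP => /andP[/U_side si /side_nbr]; rewrite si sj.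
  rewrite mul1r mulrDr mulr1; congr (_ + _); rewrite !mulr_sumr.
  rewrite [RHS](eq_bigl (fun i => (i \in A) && e j i)); last first.
    by move=> i; case: (boolP (e j i)) => [/nbrA ->|]; rewrite ?andbF.
  by apply: eq_bigr => i _; rewrite /v; field; rewrite gt_eqF.
rewrite ZE lnM ?posrE//; last by rewrite ltr_wpDr// sumr_ge0// => i _; rewrite ltW.
set K := \sum_(i | ~~ side i) row_term i
  + \sum_(i | side i && (i \notin j |: U)) column_term i
  + \sum_(i in U) #|e i|%:R * y * ln (x i).
(* This is the bound for [j |: U] at the point [x] with [x j] replaced by [t]. *)
have le_K t : 0 < t ->
    K + #|e j|%:R * y * ln t <= ln (Z alpha A) + \sum_(i | e j i) ln (1 + t * v i).
  move=> t0; pose x' i := if i == j then t else x i.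
  have x'0 i : 0 < x' i by rewrite /x'; case: ifP.
  have x'U i : i \in U -> x' i = x i.
    by move=> iU; rewrite /x'; case: eqP => // ij; rewrite -ij iU in jU.
  have := capU _ x'0; rewrite big_setU1//= {1}/x' eqxx.
  have -> : \sum_(i in U) #|e i|%:R * y * ln (x' i) =
      \sum_(i in U) #|e i|%:R * y * ln (x i).
    by apply: eq_bigr => i iU; rewrite x'U.
  rewrite addrCA [X in X <= _]addrC -/K => /le_trans; apply.
  have -> : ~: (j |: U) = A by apply/finset.setP => i; rewrite !inE negb_or.
  have fE : field_weight (j |: U) x' =1 bump alpha (w * t) (enum (e j)).
    move=> i; rewrite /field_weight /bump mem_enum /alpha /field_weight.
    rewrite -addrA; congr (1 + _).
    rewrite [X in w * X](bigID (pred1 j)) /= addrC mulrDr; congr (w * _ + _).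
      rewrite (eq_bigl (fun k => (k \in U) && e i k)).
        by apply: eq_bigr => k /andP[kU _]; rewrite x'U.
      move=> k; rewrite !inE; case: eqP => [->|_]; first by rewrite (negPf jU) andbF.
      by rewrite andbT.
    rewrite -[i \in e j]/(e j i) e_sym.
    rewrite (eq_bigl (fun k => e i j && (k == j))); last first.
      move=> k; rewrite !inE; case: eqP => [->|_]; last by rewrite !andbF.
      by rewrite andbT.
    case: (e i j) => /=; last by rewrite big_pred0 ?mulr0.
    by rewrite big_pred1_eq /x' eqxx.
  rewrite (@eq_Z _ (bump alpha (w * t) (enum (e j)))); last by move=> i _; exact: fE.
  have wt0 : 0 <= w * t by rewrite mulr_ge0// ltW.
  have le_Z : Z (bump alpha (w * t) (enum (e j))) A <= Z alpha A *
      \prod_(i <- enum (e j)) (1 + w * t * (Z alpha (A :\ i) / Z alpha A)).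
    apply: (@Z_bump_le _ _ _ false) => //; first exact: enum_uniq.
      by move=> i; rewrite mem_enum => /nbrA.
    by move=> i; rewrite mem_enum => /side_nbr ->; rewrite sj.
  have f0 i : 0 < 1 + t * v i by rewrite addr_gt0// mulr_gt0.
  have vE i : 1 + w * t * (Z alpha (A :\ i) / Z alpha A) = 1 + t * v i.
    by rewrite /v; ring.
  rewrite (eq_bigr _ (fun i _ => vE i)) big_enum /= in le_Z.
  have lnE (s : seq V) : ln (\prod_(i <- s | i \in e j) (1 + t * v i))
      = \sum_(i <- s | e j i) ln (1 + t * v i).
    elim: s => [|i s IHs]; first by rewrite !big_nil ln1.
    rewrite !big_cons -[i \in e j]/(e j i); case: (e j i) => //.
    by rewrite lnM ?posrE ?IHs// prodr_gt0.
  rewrite -lnE -lnM ?posrE ?prodr_gt0// ler_ln ?posrE ?mulr_gt0 ?prodr_gt0//.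
  by apply: Z_gt0; exact: bump_gt0.
have := ln_derivative_ge y01 erefl (deg_lt j) (fun i _ => v0 i) le_K.
apply: le_trans; rewrite /K.
have -> : \sum_(i | side i && (i \notin U)) column_term i =
    column_term j + \sum_(i | side i && (i \notin j |: U)) column_term i.
  rewrite (bigD1 j) ?sj//=; congr (_ + _); apply: eq_bigl => i.
  by rewrite !inE negb_or -andbA [(i \notin U) && _]andbC.
rewrite [column_term j]/column_term /=; lra.
Qed.

(** At [U = set0] no variable is left and all monomer weights are [1]. The induction is on the
    number of eliminated columns. *)
Lemma ln_Z_ge :
  \sum_(i | ~~ side i) row_term i + \sum_(j | side j) column_term j
    <= ln (Z (fun=> 1) finset.setT).
Proof.
suff cap n (U : {set V}) : U \subset columns -> #|columns :\: U| = n ->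
    capacity_bound U.
  have := cap _ finset.set0 (finset.sub0set _) erefl (fun=> 1) (fun=> ltr01).
  rewrite big_set0 addr0 finset.setC0.
  rewrite (@eq_Z _ (fun=> 1)) => [|v _]; last first.
    by rewrite /field_weight big_pred0 ?mulr0 ?addr0// => i; rewrite inE.
  by under [X in _ + X <= _]eq_bigl do rewrite inE andbT.
elim: n U => [|n IH] U sU cardU.
  suff -> : U = columns by exact: capacity_bound_init.
  by apply/eqP; rewrite finset.eqEsubset sU -finset.setD_eq0 -cards_eq0 cardU.
have /card_gt0P[j] : (0 < #|columns :\: U|)%N by rewrite cardU.
rewrite !inE => /andP[jU sj]; apply: (capacity_bound_step sU sj jU).
apply: IH; first by rewrite finset.subUset finset.sub1set inE sj.
move: cardU; rewrite (cardsD1 j) !inE jU sj add1n => -[<-]; congr #|pred_of_set _|.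
by apply/finset.setP => v; rewrite !inE negb_or; case: (v == j).
Qed.

End Capacity.

End MonomerDimer.

(** The sum of [row_term] and [column_term] at a cell of degree [k]. *)
Definition bethe_term (R : realType) (w y : R) (k : nat) : R :=
  let r := k%:R * y in
  - 2 * (1 - r) * ln (1 - r) + r * ln (w / y) + k%:R * (1 - y) * ln (1 - y).

(** [ln_Z_ge] is applied twice, with the color classes exchanged, so that each cell is once a row
    and once a column; hence the factor [2]. *)
Lemma ln_Z_ge_bethe (R : realType) (V : finType) (e : rel V) (side : V -> bool)
    (w y : R) (Z : (V -> R) -> {set V} -> R) :
  symmetric e -> (forall a c, e a c -> side a != side c) ->
  0 < w -> 0 < y < 1 -> (forall v, #|e v|%:R * y < 1) ->
  monomer_dimer_recursion e w Z ->
  \sum_v bethe_term w y #|e v| <= 2 * ln (Z (fun=> 1) finset.setT).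
Proof.
move=> e_sym e_side w0 y01 deg_lt ZP.
have e_negside a c : e a c -> ~~ side a != ~~ side c.
  by move=> /e_side; case: (side a) (side c) => [] [].
have le1 := ln_Z_ge e_side w0 ZP e_sym y01 deg_lt.
have le2 := ln_Z_ge e_negside w0 ZP e_sym y01 deg_lt.
have sideK : (fun v => ~~ ~~ side v) =1 side by move=> v; rewrite negbK.
rewrite (eq_bigl _ _ sideK) in le2.
rewrite (bigID side) /=.
have split_term P : \sum_(v | P v) bethe_term w y #|e v| =
    \sum_(v | P v) row_term e w y v + \sum_(v | P v) column_term e y v.
  rewrite -big_split; apply: eq_bigr => v _.
  by rewrite /row_term /column_term /bethe_term /=; ring.
rewrite !split_term; lra.
Qed.

(** * Tilings of a box as matchings of the grid *)

Section Dimers.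
Variables (d : nat) (m : 'I_d -> nat).
Local Notation color := 'I_(2 * d).+1.
Implicit Types (i j : box m) (k : 'I_d) (q : color).

(** The color at the other end of a dimer. The monomer is a fixed point, which makes this an
    involution on all colors. *)
Definition opposite q : color :=
  inord (if (q < d)%N then q + d else if (q < 2 * d)%N then q - d else q)%N.

Definition monomer : color := ord_max.

Lemma val_opposite q : opposite q =
  (if (q < d)%N then q + d else if (q < 2 * d)%N then q - d else q)%N :> nat.
Proof.
rewrite inordK//; have := ltn_ord q; case: ifP => ?; first by lia.
by case: ifP => ?; lia.
Qed.

Lemma oppositeK : involutive opposite.
Proof.
move=> q; apply: val_inj; rewrite /= !val_opposite.
have := ltn_ord q; case: (ltnP q d) => ?; last case: (ltnP q (2 * d)) => ?;
  by repeat case: ifP => ?; lia.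
Qed.

Lemma neq_monomer q : (q != monomer) = (q < 2 * d)%N.
Proof. by rewrite -val_eqE /=; have := ltn_ord q; lia. Qed.

Lemma opposite_monomer q : (opposite q == monomer) = (q == monomer).
Proof.
apply/negb_inj; rewrite !neq_monomer val_opposite.
by have := ltn_ord q; case: ifP => ?; [|case: ifP => ?]; lia.
Qed.

(** The color [q] at [i] points to the cell [j]; the monomer color points nowhere. *)
Definition nbr q i j : bool :=
  [exists k : 'I_d, (q == k :> nat)%N && next_in k i j
    || (q == k + d :> nat)%N && next_in k j i].

Definition adjacent_cells i j : bool := [exists q : color, nbr q i j].

Lemma next_inP k i j :
  reflect (forall l, j l = (i l + (l == k))%N :> nat) (next_in k i j).
Proof. by apply: (iffP forallP) => H l; apply/eqP/H. Qed.

Lemma next_in_inj k i j j' : next_in k i j -> next_in k i j' -> j = j'.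
Proof.
by move=> /next_inP H /next_inP H'; apply/ffunP => l; apply: val_inj; rewrite /= H H'.
Qed.

Lemma prev_in_inj k i j j' : next_in k j i -> next_in k j' i -> j = j'.
Proof.
move=> /next_inP H /next_inP H'; apply/ffunP => l; apply: val_inj => /=.
by apply/eqP; rewrite -(eqn_add2r (l == k)) -H -H'.
Qed.

Lemma next_in_dir k k' i j : next_in k i j -> next_in k' i j -> k = k'.
Proof.
move=> /next_inP /(_ k) H /next_inP /(_ k); rewrite H eqxx.
by case: eqP => //=; lia.
Qed.

Lemma next_in_asym k k' i j : next_in k i j -> next_in k' j i -> False.
Proof. by move=> /next_inP /(_ k) H /next_inP /(_ k); rewrite H eqxx; lia. Qed.

Lemma nbr_fun q i j j' : nbr q i j -> nbr q i j' -> j = j'.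
Proof.
case/existsP => k /orP[] /andP[/eqP qk ij];
  case/existsP => k' /orP[] /andP[/eqP qk' ij'];
  have := ltn_ord k; have := ltn_ord k' => ? ?; try lia.
- have kk' : k = k' by apply: val_inj; rewrite /= -qk.
  by rewrite -kk' in ij'; exact: next_in_inj ij ij'.
- have kk' : k = k' by apply: val_inj; rewrite /=; lia.
  by rewrite -kk' in ij'; exact: prev_in_inj ij ij'.
Qed.

Lemma nbr_color q q' i j : nbr q i j -> nbr q' i j -> q = q'.
Proof.
case/existsP => k /orP[] /andP[/eqP qk ij];
  case/existsP => k' /orP[] /andP[/eqP qk' ij'].
- by apply: val_inj; rewrite /= qk qk' (next_in_dir ij ij').
- by have := next_in_asym ij ij'.
- by have := next_in_asym ij ij'.
- by apply: val_inj; rewrite /= qk qk' (next_in_dir ij ij').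
Qed.

Lemma nbr_sym q i j : nbr q i j = nbr (opposite q) j i.
Proof.
suff imp q' i' j' : nbr q' i' j' -> nbr (opposite q') j' i'.
  by apply/idP/idP => /imp //; rewrite oppositeK.
case/existsP => k /orP[] /andP[/eqP qk ij]; have ? := ltn_ord k;
  apply/existsP; exists k; rewrite ij val_opposite qk.
- by rewrite ltn_ord eqxx orbT.
- by rewrite ltnNge leq_addl/= (_ : (k + d < 2 * d)%N) ?addnK ?eqxx//; lia.
Qed.

Lemma nbr_neq_monomer q i j : nbr q i j -> q != monomer.
Proof.
case/existsP => k /orP[] /andP[/eqP qk _]; have ? := ltn_ord k;
  by rewrite neq_monomer qk; lia.
Qed.

(** The checkerboard coloring, which shows that the grid is bipartite. *)
Definition odd_cell i : bool := odd (\sum_l i l).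

Lemma nbr_odd q i j : nbr q i j -> odd_cell i != odd_cell j.
Proof.
have next k i' j' : next_in k i' j' -> odd_cell i' != odd_cell j'.
  move=> /next_inP H; rewrite /odd_cell (eq_bigr _ (fun l _ => H l)) big_split /=.
  by rewrite -big_mkcond /= big_pred1_eq addn1 /=; case: odd.
by case/existsP => k /orP[] /andP[_ /next] //; rewrite eq_sym.
Qed.

Lemma nbr_neq q i j : nbr q i j -> i != j.
Proof. by move=> /nbr_odd; apply: contraNneq => ->. Qed.

Lemma adjacent_cells_sym : symmetric adjacent_cells.
Proof.
by move=> i j; apply/existsP/existsP => -[q]; rewrite nbr_sym => ?; exists (opposite q).
Qed.

Lemma adjacent_cells_odd i j : adjacent_cells i j -> odd_cell i != odd_cell j.
Proof. by case/existsP => q /nbr_odd. Qed.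

Lemma exists_next k i : ((i k).+1 < m k)%N -> exists j, next_in k i j.
Proof.
move=> lt_ik; have lt l : (i l + (l == k) < m l)%N.
  by case: eqP => [->|_]; rewrite ?addn1 ?addn0.
by exists [ffun l => Ordinal (lt l)]; apply/next_inP => l; rewrite ffunE.
Qed.

Lemma exists_prev k i : (0 < i k)%N -> exists j, next_in k j i.
Proof.
move=> i0; have lt l : (i l - (l == k) < m l)%N.
  by rewrite (leq_ltn_trans (leq_subr _ _)).
exists [ffun l => Ordinal (lt l)]; apply/next_inP => l; rewrite ffunE /= subnK//.
by case: eqP => [->|].
Qed.

(** The boundary conditions in [tilings] provide the cell at the other end of each dimer, and
    [Gamma] forces its color. Conversely, both follow when every dimer half is answered by its
    partner. *)
Lemma tilingP (phi : coloring (2 * d).+1 m) :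
  reflect (forall i, phi i != monomer ->
             exists2 j, nbr (phi i) i j & phi j = opposite (phi i))
          (phi \in tilings m).
Proof.
apply: (iffP idP) => [|H].
  rewrite !inE => /andP[/forallP Hcov /forallP Hbd] i.
  rewrite neq_monomer => lt_i; have [lt_d|ge_d] := ltnP (phi i) d.
    pose k := Ordinal lt_d.
    have /forallP/(_ i)/andP[+ _] := Hbd k; rewrite eqxx /= => nbd.
    have [|j ij] := @exists_next k i; first by rewrite ltn_neqAle nbd ltn_ord.
    exists j; first by apply/existsP; exists k; rewrite eqxx ij.
    have /forallP/(_ i)/forallP/(_ j) := Hcov k; rewrite ij /= /Gamma eqxx => /eqP phij.
    by apply: val_inj; rewrite /= phij val_opposite lt_d.
  have lt_k : (phi i - d < d)%N by lia.
  pose k := Ordinal lt_k.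
  have phik : (phi i == k + d :> nat)%N by rewrite /= subnK.
  have /forallP/(_ i)/andP[_ +] := Hbd k; rewrite phik /= -lt0n => nbd.
  have [j ji] := exists_prev nbd.
  exists j; first by apply/existsP; exists k; rewrite phik ji orbT.
  have /forallP/(_ j)/forallP/(_ i) := Hcov k; rewrite ji /= /Gamma.
  case: eqP => [phij _|_]; last by rewrite phik.
  by apply: val_inj; rewrite /= phij val_opposite ltnNge ge_d lt_i.
rewrite !inE; apply/andP; split; apply/forallP => k; apply/forallP => i.
  apply/forallP => j; apply/implyP => ij; rewrite /Gamma.
  have kd := ltn_ord k.
  case: eqP => [phik|phik].
    have [|j' ij' phij] := H i; first by rewrite neq_monomer phik; lia.
    have -> : j = j'.
      by apply: nbr_fun ij'; apply/existsP; exists k; rewrite phik eqxx ij.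
    by rewrite phij val_opposite phik kd.
  (* The negative clause of [Gamma]: if [j] has color [k + d], it points back to [i], so [i] has
     color [k]. *)
  apply/eqP => phij; apply: phik.
  have [|i' ji' phii] := H j; first by rewrite neq_monomer phij; lia.
  have -> : i = i'.
    by apply: nbr_fun ji'; apply/existsP; exists k; rewrite phij eqxx ij orbT.
  rewrite phii val_opposite phij ltnNge leq_addl/= (_ : (k + d < 2 * d)%N) ?addnK//.
  by lia.
have kd := ltn_ord k.
apply/andP; split; apply/negP => /andP[/eqP phik /eqP ik].
  have [|j /existsP[k' /orP[]/andP[/eqP phik' ij]] _] := H i.
  - by rewrite neq_monomer phik; lia.
  - have kk' : k = k' by apply: val_inj; rewrite /= -phik.
    move/next_inP: ij => /(_ k); rewrite -kk' eqxx addn1 ik => jk.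
    by have := ltn_ord (j k); rewrite jk ltnn.
  - by lia.
have [|j /existsP[k' /orP[]/andP[/eqP phik' ij]] _] := H i.
- by rewrite neq_monomer phik; lia.
- by have := ltn_ord k'; lia.
- have kk' : k = k' by apply: val_inj => /=; lia.
  by move/next_inP: ij => /(_ k); rewrite -kk' eqxx addn1 ik.
Qed.

End Dimers.

(** * The partition function of tilings and its recursion *)

Section PartitionFunction.
Variables (R : realType) (d : nat) (m : 'I_d -> nat) (w : R).
Local Notation color := 'I_(2 * d).+1.
Local Notation mono := (monomer d).
Implicit Types (i j a c : box m) (q : color) (A : {set box m}).
Implicit Types (phi psi : coloring (2 * d).+1 m).

(** Tilings of a subset [A] are extended by monomers, so that all subsets share one type of
    colorings. *)
Definition tiles A phi : bool :=
  (phi \in tilings m) && [forall i, (i \notin A) ==> (phi i == mono)].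

(** The weight [w] of a dimer is carried by its end of color below [d], and the other end has weight
    [1]. *)
Definition color_weight (alpha : box m -> R) i q : R :=
  if (q < d)%N then w else if q == mono then alpha i else 1.

Definition partition_function (alpha : box m -> R) A : R :=
  \sum_(phi | tiles A phi) \prod_(i in A) color_weight alpha i (phi i).

Lemma tilesP A phi : reflect
  ((forall i, phi i != mono -> exists2 j, nbr (phi i) i j & phi j = opposite (phi i))
   /\ (forall i, i \notin A -> phi i = mono))
  (tiles A phi).
Proof.
apply: (iffP andP) => -[H1 H2]; split.
- exact/tilingP.
- by move=> i iA; apply/eqP; have /implyP := forallP H2 i; apply.
- exact/tilingP.
- by apply/forallP => i; apply/implyP => /H2 ->.
Qed.

Definition add_dimer a c q psi : coloring (2 * d).+1 m :=
  [ffun i => if i == a then q else if i == c then opposite q else psi i].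

Definition remove_dimer a c phi : coloring (2 * d).+1 m :=
  [ffun i => if (i == a) || (i == c) then mono else phi i].

Lemma tiles_add_dimer A a c q psi : nbr q a c -> a \in A -> c \in A ->
  tiles (A :\ a :\ c) psi -> tiles A (add_dimer a c q psi).
Proof.
move=> qac aA cA /tilesP[Hpsi out]; apply/tilesP; split; last first.
  move=> i iA; rewrite ffunE; case: eqP => [ia|_]; first by rewrite ia aA in iA.
  case: eqP => [ic|_]; first by rewrite ic cA in iA.
  by apply: out; rewrite !inE (negPf iA) !andbF.
have neq_ac := nbr_neq qac.
move=> i; rewrite ffunE; case: (eqVneq i a) => [->|neq_ia].
  by exists c => //; rewrite ffunE eq_sym (negPf neq_ac) eqxx.
case: (eqVneq i c) => [->|neq_ic].
  by exists a; rewrite -?nbr_sym// ffunE eqxx oppositeK.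
move=> psii; have [j ij psij] := Hpsi i psii; exists j => //; rewrite ffunE.
have psijm : psi j != mono by rewrite psij opposite_monomer.
by case: eqP => [ja|_]; [|case: eqP => [ja|//]];
  move: psijm; rewrite ja out ?eqxx// !inE eqxx ?andbF.
Qed.

Lemma tiles_dimer A a c phi : tiles A phi -> nbr (phi a) a c ->
  phi c = opposite (phi a).
Proof.
move=> /tilesP[Hphi _] ac; have [c' ac' <-] := Hphi a (nbr_neq_monomer ac).
by rewrite (nbr_fun ac ac').
Qed.

Lemma tiles_remove_dimer A a c phi : tiles A phi -> nbr (phi a) a c ->
  tiles (A :\ a :\ c) (remove_dimer a c phi).
Proof.
move=> tphi ac; have phic := tiles_dimer tphi ac.
have /tilesP[Hphi out] := tphi; apply/tilesP; split; last first.
  move=> i; rewrite ffunE !inE; case: ifP => // /norP[-> ->] /=; exact: out.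
move=> i; rewrite ffunE; case: ifP => [_|/norP[neq_ia neq_ic]]; first by rewrite eqxx.
move=> phii; have [j ij phij] := Hphi i phii; exists j => //; rewrite ffunE.
case: eqP => [ja|_] /=.
  move: ij; rewrite nbr_sym -phij ja => /(nbr_fun ac) ci.
  by rewrite ci eqxx in neq_ic.
case: eqP => [jc|//]; move: ij; rewrite nbr_sym -phij jc phic.
rewrite nbr_sym in ac; move=> /(nbr_fun ac) ai.
by rewrite ai eqxx in neq_ia.
Qed.

Lemma add_dimerK A a c q psi : nbr q a c -> tiles (A :\ a :\ c) psi ->
  remove_dimer a c (add_dimer a c q psi) = psi.
Proof.
move=> qac /tilesP[_ out]; apply/ffunP => i; rewrite !ffunE.
case: eqP => [->|_] /=; first by rewrite out // !inE eqxx andbF.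
by case: eqP => [->|//]; rewrite out // !inE eqxx.
Qed.

Lemma remove_dimerK A a c phi : tiles A phi -> nbr (phi a) a c ->
  add_dimer a c (phi a) (remove_dimer a c phi) = phi.
Proof.
move=> tphi ac; apply/ffunP => i; rewrite !ffunE.
case: eqP => [->//|_] /=; case: eqP => [->|//].
by rewrite (tiles_dimer tphi ac).
Qed.

Lemma partition_function0 alpha : partition_function alpha finset.set0 = 1.
Proof.
pose phi0 : coloring (2 * d).+1 m := [ffun=> mono].
rewrite /partition_function (big_pred1 phi0) ?big_set0// => phi /=.
apply/tilesP/eqP => [[_ out]|->].
  by apply/ffunP => i; rewrite ffunE out ?inE.
by split=> i; rewrite ffunE ?eqxx.
Qed.

Lemma weight_dimer alpha q i j : q != mono ->
  color_weight alpha i q * color_weight alpha j (opposite q) = w.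
Proof.
rewrite /color_weight opposite_monomer => qm; rewrite (negPf qm).
rewrite neq_monomer in qm; rewrite val_opposite.
case: (ltnP q d) => qd; first by rewrite ltnNge leq_addl /= mulr1.
by rewrite qm (_ : (q - d < d)%N) ?mul1r//; lia.
Qed.

(** Removing the dimer on [a] and [c] is a bijection onto the tilings of the remaining cells, and
    its two ends contribute [w] together. *)
Lemma sum_dimer A a c q alpha : nbr q a c -> a \in A -> c \in A ->
  \sum_(phi | tiles A phi && nbr (phi a) a c)
     \prod_(i in A) color_weight alpha i (phi i)
  = w * partition_function alpha (A :\ a :\ c).
Proof.
move=> qac aA cA; rewrite mulr_sumr.
rewrite (reindex_onto (add_dimer a c q) (remove_dimer a c)) /=; last first.
  move=> phi /andP[tphi ac].
  by rewrite -{2}(remove_dimerK tphi ac) (nbr_color qac ac).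
have neq_ac := nbr_neq qac.
have caA : c \in A :\ a by rewrite !inE eq_sym neq_ac.
apply: eq_big => [psi|psi tpsi].
  apply/andP/idP => [[/andP[tphi _] /eqP <-]|tpsi].
    by apply: tiles_remove_dimer => //; rewrite ffunE eqxx.
  by rewrite (add_dimerK qac tpsi) eqxx tiles_add_dimer // ffunE eqxx.
rewrite (big_setD1 a aA) (big_setD1 c caA) /= !ffunE eqxx.
rewrite [c == a]eq_sym (negPf neq_ac) eqxx.
rewrite mulrA weight_dimer ?(nbr_neq_monomer qac)//; congr (_ * _).
apply: eq_bigr => i; rewrite !inE ffunE => /and3P[ic ia _].
by rewrite (negPf ia) (negPf ic).
Qed.

Lemma sum_monomer A a alpha : a \in A ->
  \sum_(phi | tiles A phi && (phi a == mono))
     \prod_(i in A) color_weight alpha i (phi i)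
  = alpha a * partition_function alpha (A :\ a).
Proof.
move=> aA; rewrite mulr_sumr; apply: eq_big => [phi|phi /andP[_ /eqP phia]].
  apply/andP/tilesP => [[/tilesP[Hphi out] /eqP phia]|[Hphi out]].
    split=> // i; rewrite !inE negb_and negbK => /orP[/eqP ->//|]; exact: out.
  split; last by rewrite out // !inE eqxx.
  by apply/tilesP; split=> // i iA; apply: out; rewrite !inE (negPf iA) andbF.
rewrite (big_setD1 a aA) /= phia /color_weight eqxx /= ltnNge.
by rewrite (_ : (d <= 2 * d)%N)//; lia.
Qed.

Lemma partition_function_recursion :
  monomer_dimer_recursion (@adjacent_cells d m) w partition_function.
Proof.
split=> [|alpha A a aA]; first exact: partition_function0.
rewrite {1}/partition_function (bigID (fun phi : coloring _ _ => phi a == mono)) /=.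
rewrite sum_monomer//; congr (_ + _).
(* Tilings in which [a] is not a monomer are sorted by the other end of the dimer at [a]. That end
   exists for all of them, so the default [a] does not occur. *)
pose partner (phi : coloring (2 * d).+1 m) := odflt a [pick c | nbr (phi a) a c].
have partnerE phi c : nbr (phi a) a c -> partner phi = c.
  move=> ac; rewrite /partner; case: pickP => [c' ac'|/(_ c)]; last by rewrite ac.
  by rewrite (nbr_fun ac ac').
rewrite (partition_big partner
  (fun c => (c \in A :\ a) && adjacent_cells a c)) /=; last first.
  move=> phi /andP[tphi phia]; have /tilesP[Hphi out] := tphi.
  have [c ac phic] := Hphi a phia.
  rewrite (partnerE _ _ ac) !inE eq_sym (nbr_neq ac) /=.
  apply/andP; split; last by apply/existsP; exists (phi a).
  apply/negPn/negP => /out phic'.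
  by move: phia; rewrite -opposite_monomer -phic phic' eqxx.
rewrite mulr_sumr; apply: eq_bigr => c /andP[/finset.setD1P[ca cA] /existsP[q qac]].
rewrite -(sum_dimer alpha qac aA cA); apply: eq_bigl => phi.
apply/andP/andP => [[/andP[tphi phia] /eqP pc]|[tphi ac]]; split=> //.
- have /tilesP[Hphi _] := tphi; have [c' ac' _] := Hphi a phia.
  by rewrite -pc (partnerE _ _ ac').
- by rewrite tphi (nbr_neq_monomer ac).
- by rewrite (partnerE _ _ ac).
Qed.

Lemma partition_functionT :
  partition_function (fun=> 1) finset.setT =
    \sum_(phi in tilings m) w ^+ #|[pred i | (phi i < d)%N]|.
Proof.
apply: eq_big => [phi|phi _].
  rewrite /tiles andb_idr// => _; apply/forallP => i; rewrite finset.in_setT //.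
rewrite -prodr_const big_mkcond [RHS]big_mkcond /=.
apply: eq_bigr => i _; rewrite finset.in_setT /color_weight !inE.
by case: ifP => // _; case: ifP.
Qed.

End PartitionFunction.

(** * Slices, boundary and degrees in a box *)

Section BoxGeometry.
Variables (d : nat) (m : 'I_d -> nat).
Implicit Types (i j : box m) (k : 'I_d).

Lemma card_box_family (F : forall k, pred 'I_(m k)) :
  #|[pred i : box m | [forall k, F k (i k)]]| = (\prod_k #|F k|)%N.
Proof.
have -> : #|[pred i : box m | [forall k, F k (i k)]]| = #|(family F : pred (box m))|.
  by apply: eq_card => f; rewrite !inE.
by rewrite card_family foldrE big_map big_enum.
Qed.

Lemma card_box : #|box m| = volume m.
Proof.
have -> : #|box m| = #|[pred i : box m | [forall k, predT (i k)]]|.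
  by apply: eq_card => f; rewrite !inE; apply/esym/forallP.
rewrite (card_box_family (fun k => predT : pred 'I_(m k))).
by apply: eq_bigr => k _; rewrite card_ord.
Qed.

(** Fixing one coordinate leaves at most one of its [m k] values, and none if [c] is out of
    range. *)
Lemma card_slice_le k (c : nat) :
  (#|[pred i : box m | (i k == c :> nat)%N]| * m k <= volume m)%N.
Proof.
pose F l : pred 'I_(m l) := fun x => (l == k) ==> (x == c :> nat)%N.
have -> : #|[pred i : box m | (i k == c :> nat)%N]| =
    #|[pred i : box m | [forall l, F l (i l)]]|.
  apply: eq_card => i; rewrite !inE; apply/idP/forallP => [ik l|/(_ k)].
    by rewrite /F; apply/implyP => /eqP ->.
  by rewrite /F eqxx.
rewrite card_box_family /volume (bigD1 k)//= [in leqRHS](bigD1 k)//= mulnAC.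
rewrite leq_mul//; last first.
  by apply: leq_prod => l _; rewrite -[leqRHS]card_ord max_card.
rewrite -[leqRHS]mul1n leq_mul2r; apply/orP; right.
apply/card_le1_eqP => x x'; rewrite -[x \in _]/(F k x) -[x' \in _]/(F k x').
rewrite /F eqxx /= => /eqP xc /eqP x'c.
by apply: val_inj; rewrite /= xc x'c.
Qed.

Definition interior_cell i : bool :=
  [forall k, (0 < i k)%N && ((i k).+1 < m k)%N].

(** The boundary is covered by [2 * d] slices, each containing at most a fraction [1 / n] of the
    cells. *)
Lemma card_boundary_le (n : nat) : (forall k, (n <= m k)%N) ->
  (#|[pred i : box m | ~~ interior_cell i]| * n <= 2 * d * volume m)%N.
Proof.
move=> le_nm.
have end_point (a b : nat) : (a < b)%N -> ~~ (0 < a)%N || ~~ (a.+1 < b)%N ->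
    (0 < (a == 0) + (a == b.-1))%N.
  by case: eqP => // ?; case: eqP => // ?; lia.
have le_bd : (#|[pred i : box m | ~~ interior_cell i]| <=
    \sum_k (#|[pred i : box m | (i k == 0 :> nat)%N]| +
            #|[pred i : box m | (i k == (m k).-1 :> nat)%N]|))%N.
  rewrite -sum1_card (eq_bigr (fun k =>
    \sum_(i : box m) ((i k == 0 :> nat)%N + (i k == (m k).-1 :> nat)%N))%N); last first.
    move=> k _; rewrite -!sum1_card big_split /=.
    by congr (_ + _)%N; rewrite big_mkcond; apply: eq_bigr => i _ /=;
      rewrite inE; case: eqP.
  rewrite exchange_big big_mkcond /=; apply: leq_sum => i _. rewrite inE.
  case: ifP => // /forallPn[k]; rewrite negb_and => bd.
  rewrite (bigD1 k)//=; apply: leq_trans (leq_addr _ _).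
  exact: end_point (ltn_ord (i k)) bd.
apply: leq_trans (leq_mul le_bd (leqnn n)) _.
rewrite big_distrl /= -[X in (_ <= 2 * X * _)%N]card_ord -sum1_card.
rewrite big_distrr big_distrl /=; apply: leq_sum => k _.
have slice c := leq_trans (leq_mul (leqnn _) (le_nm k)) (card_slice_le k c).
by rewrite muln1 mulnDl mul2n -addnn leq_add ?slice.
Qed.

(** Distinct neighbors are reached by distinct colors, and the monomer color reaches none. *)
Lemma degree_le i : (#|adjacent_cells i| <= 2 * d)%N.
Proof.
pose dir j := odflt (monomer d) [pick q | nbr q i j].
have dirP j : adjacent_cells i j -> nbr (dir j) i j.
  by case/existsP => q ij; rewrite /dir; case: pickP => // /(_ q); rewrite ij.
have dir_inj : {in adjacent_cells i &, injective dir}.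
  by move=> j j' /dirP ij /dirP ij' djj'; rewrite djj' in ij; exact: nbr_fun ij ij'.
rewrite -(card_in_image dir_inj) -ltnS -[ltnRHS]card_ord.
apply: (@proper_card _ _ predT); apply/properP; split; first by apply/fintype.subsetP.
exists (monomer d) => //; apply/negP => /fintype.imageP[j ij monoE].
by have := nbr_neq_monomer (dirP j ij); rewrite -monoE eqxx.
Qed.

Lemma interior_nbr i (q : 'I_(2 * d).+1) :
  interior_cell i -> q != monomer d -> exists j, nbr q i j.
Proof.
move=> /forallP int_i; rewrite neq_monomer => lt_q; have [lt_d|ge_d] := ltnP q d.
  have /andP[_ /exists_next[j ij]] := int_i (Ordinal lt_d).
  by exists j; apply/existsP; exists (Ordinal lt_d); rewrite eqxx ij.
have lt_k : (q - d < d)%N by lia.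
have /andP[/exists_prev[j ij] _] := int_i (Ordinal lt_k).
by exists j; apply/existsP; exists (Ordinal lt_k); rewrite ij /= subnK ?eqxx ?orbT.
Qed.

Lemma degree_interior i : interior_cell i -> #|adjacent_cells i| = (2 * d)%N.
Proof.
move=> int_i; apply/eqP; rewrite eqn_leq degree_le /=.
pose to q := odflt i [pick j | nbr q i j].
have toP q : q != monomer d -> nbr q i (to q).
  move=> /(interior_nbr int_i)[j ij]; rewrite /to.
  by case: pickP => // /(_ j); rewrite ij.
have to_inj : {in predC1 (monomer d) &, injective to}.
  by move=> q q' /toP iq /toP iq' E; rewrite E in iq; exact: nbr_color iq iq'.
have <- : #|predC1 (monomer d)| = (2 * d)%N by rewrite cardC1 card_ord.
rewrite -(card_in_image to_inj); apply: subset_leq_card; apply/fintype.subsetP => j.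
by case/fintype.imageP => q /toP iq ->; apply/existsP; exists q.
Qed.

(** The involution [mu] swaps the ends of every dimer, so colors below [d] occur as often as colors
    from [d] to [2 * d - 1]. *)
Lemma tiling_balanced (phi : coloring (2 * d).+1 m) : phi \in tilings m ->
  (2 * #|[pred i | (phi i < d)%N]| + #|[pred i | phi i == monomer d]| = volume m)%N.
Proof.
move/tilingP => Hphi.
pose mu i := odflt i [pick j | nbr (phi i) i j].
have muP i : phi i != monomer d ->
    nbr (phi i) i (mu i) /\ phi (mu i) = opposite (phi i).
  move=> /Hphi[j ij phij]; rewrite /mu.
  case: pickP => [j' ij'|/(_ j)]; last by rewrite ij.
  by rewrite /= -(nbr_fun ij ij') ij phij.
have muE i : phi i = monomer d -> mu i = i.
  move=> phii; rewrite /mu; case: pickP => // j /nbr_neq_monomer.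
  by rewrite phii eqxx.
have muK : involutive mu.
  move=> i; case: (eqVneq (phi i) (monomer d)) => [phii|phii]; first by rewrite !muE.
  have [ij phij] := muP i phii; have [|ji _] := muP (mu i).
    by rewrite phij opposite_monomer.
  by rewrite phij in ji; rewrite nbr_sym in ij; exact: nbr_fun ji ij.
have cards : #|[pred i | (phi i < d)%N]| = #|[pred i | (d <= phi i < 2 * d)%N]|.
  rewrite -(fintype.card_image (can_inj muK)); apply: eq_card => i; rewrite inE.
  apply/fintype.imageP/idP => [[j]|lt_i].
    rewrite inE => lt_j ->; have [|_ ->] := muP j; first by rewrite neq_monomer; lia.
    by rewrite val_opposite lt_j; lia.
  exists (mu i); rewrite ?muK// inE.
  have [|_ ->] := muP i; first by rewrite neq_monomer; lia.
  by rewrite val_opposite; do ![case: ifP => ?]; lia.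
rewrite mul2n -addnn {2}cards -card_box.
rewrite -(cardC [pred i | (phi i < d)%N]) -addnA; congr (_ + _)%N.
rewrite -[in RHS](cardID [pred i | (phi i < 2 * d)%N]).
congr (_ + _)%N; apply: eq_card => i; rewrite !inE; first by lia.
by rewrite -[phi i == _]negbK neq_monomer; lia.
Qed.

End BoxGeometry.

(** * The pressure of a finite box *)

Lemma exists_ge_average (R : realType) (n : nat) (F : nat -> R) :
  exists2 s, (s <= n)%N & \sum_(j < n.+1) F j <= n.+1%:R * F s.
Proof.
elim: n => [|n [s le_sn leF]]; first by exists 0%N; rewrite // big_ord1 mul1r.
have [leFs|/ltW leFs] := leP (F n.+1) (F s).
  by exists s; rewrite ?leqW// big_ord_recr/= -[n.+2]addn1 natrD mulrDl mul1r lerD.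
exists n.+1 => //; rewrite big_ord_recr/= -[n.+2]addn1 natrD mulrDl mul1r lerD//.
by rewrite (le_trans leF)// ler_wpM2l.
Qed.

Section BoxPressure.
Variables (R : realType) (d : nat).
Hypothesis d_gt0 : (0 < d)%N.

(** The contribution of an interior cell when the density [theta] is spread evenly over its [2 * d]
    edges. *)
Definition bethe_pressure (w theta : R) : R :=
  bethe_term w (theta / (2 * d%:R)) (2 * d).

(** Only boundary cells deviate from [bethe_pressure], each by a bounded amount, and their share of
    the volume is of order [1 / n]. *)
Lemma interior_sum_ge (w theta : R) : exists2 C, 0 <= C &
  forall (m : 'I_d -> nat) n, (0 < n)%N -> (forall k, (n <= m k)%N) ->
  (volume m)%:R * (bethe_pressure w theta - C / n%:R)
    <= \sum_(i : box m) bethe_term w (theta / (2 * d%:R)) #|adjacent_cells i|.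
Proof.
set y := theta / _; set b := bethe_term w y; set F := bethe_pressure _ _.
(* [C0] dominates the deviation at every degree that can occur. *)
pose C0 := \sum_(j < (2 * d).+1) `|F - b j|.
have C0_ge0 : 0 <= C0 by apply: sumr_ge0.
exists (2 * d%:R * C0) => [|m n n0 le_nm]; first by rewrite !mulr_ge0.
have lower (i : box m) :
    F - (if interior_cell i then 0 else C0) <= b #|adjacent_cells i|.
  case: ifP => [/degree_interior ->|_]; first by rewrite subr0 lexx.
  have lt_deg : (#|adjacent_cells i| < (2 * d).+1)%N by rewrite ltnS degree_le.
  have : `|F - b #|adjacent_cells i| | <= C0.
    by rewrite /C0 (bigD1 (Ordinal lt_deg))//= ler_wpDr// sumr_ge0.
  by rewrite ler_norml => /andP[_]; lra.
apply: le_trans (ler_sum (index_enum _) (fun i _ => lower i)).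
rewrite sumrB sumr_const card_box -[F *+ _]mulr_natl mulrBr lerB//.
rewrite (eq_bigr (fun i => if ~~ interior_cell i then C0 else 0)); last first.
  by move=> i _; case: ifP.
rewrite -big_mkcond sumr_const /=.
have := @card_boundary_le d m n le_nm; rewrite -(ler_nat R) !natrM => bd.
rewrite (_ : _ * (_ / _) = (2 * d%:R * (volume m)%:R) / n%:R * C0); last by ring.
by rewrite -[C0 *+ _]mulr_natl ler_wpM2r// ler_pdivlMr// ltr0n.
Qed.

Lemma tilings_sum (m : 'I_d -> nat) (w : R) :
  \sum_(phi in tilings m) w ^+ #|[pred i | (phi i < d)%N]| =
  \sum_(s < (volume m).+1) #|tilings_with m s|%:R * w ^+ s.
Proof.
pose size (phi : coloring (2 * d).+1 m) := #|[pred i | (phi i < d)%N]|.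
have lt_size phi : (size phi < (volume m).+1)%N.
  by rewrite ltnS -card_box max_card.
rewrite (partition_big (fun phi => Ordinal (lt_size phi)) predT)//=.
apply: eq_bigr => s _; rewrite mulr_natl -sumr_const; apply: eq_big => phi.
  by rewrite [in RHS]inE -val_eqE.
by case/andP => _ /eqP <-.
Qed.

Lemma tilings_with_size (m : 'I_d -> nat) s :
  (0 < #|tilings_with m s|)%N -> (2 * s <= volume m)%N.
Proof.
case/card_gt0P => phi; rewrite inE => /andP[/tiling_balanced <- /eqP <-].
exact: leq_addr.
Qed.

(** Some term of the partition function, sorted by the number of dimers, is at least the average;
    this costs a factor [volume m + 1]. *)
Lemma dominant_size (m : 'I_d -> nat) (w theta : R) : 0 < w -> 0 < theta < 1 ->
  exists s, [/\ (2 * s <= volume m)%N &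
    \sum_(i : box m) bethe_term w (theta / (2 * d%:R)) #|adjacent_cells i|
      <= 2 * (ln (volume m).+1%:R + ln #|tilings_with m s|%:R + s%:R * ln w)].
Proof.
move=> w0 /andP[t0 t1]; set y := theta / _.
have d0 : 0 < d%:R :> R by rewrite ltr0n.
have d1 : 1 <= d%:R :> R by rewrite ler1n.
have y01 : 0 < y < 1.
  by rewrite /y divr_gt0 ?mulr_gt0//= ltr_pdivrMr ?mulr_gt0//; lra.
have deg_lt (i : box m) : #|adjacent_cells i|%:R * y < 1.
  apply: (@le_lt_trans _ _ theta) => //.
  rewrite -[leRHS](@divfK _ (2 * d%:R)); last by rewrite gt_eqF ?mulr_gt0.
  rewrite mulrC ler_wpM2l ?(ltW (proj1 (andP y01)))//.
  by rewrite -natrM ler_nat degree_le.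
have := ln_Z_ge_bethe (@adjacent_cells_sym d m) (@adjacent_cells_odd d m) w0 y01 deg_lt
  (partition_function_recursion m w).
rewrite partition_functionT tilings_sum.
have [s _] :=
  exists_ge_average (volume m) (fun s => #|tilings_with m s|%:R * w ^+ s).
set Z := \sum_(_ < _) _ => leZ.
have Z0 : 0 < Z.
  rewrite /Z -tilings_sum -partition_functionT.
  exact: (Z_gt0 w0 (partition_function_recursion m w) finset.setT (fun=> ltr01)).
(* Since [Z] is positive, so is the chosen term. This lets its logarithm be split and yields the
   bound on [s]. *)
have Ns0 : (0 < #|tilings_with m s|)%N.
  rewrite lt0n; apply/eqP => N0; move: leZ; rewrite N0 mul0r mulr0 => /(lt_le_trans Z0).
  by rewrite ltxx.
move=> /le_trans le; exists s; split; first exact: tilings_with_size.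
apply: le; rewrite ler_pM2l// [s%:R * _]mulr_natl.
rewrite -lnXn// -!lnM ?posrE ?mulr_gt0 ?ltr0n ?exprn_gt0//.
by rewrite ler_ln ?posrE ?mulr_gt0 ?ltr0n ?exprn_gt0// -mulrA.
Qed.

End BoxPressure.

Lemma ln_nat_ge0 (R : realType) (n : nat) : 0 <= ln n%:R :> R.
Proof. by case: n => [|n]; [rewrite ln0 | rewrite ln_ge0 ?ler1n]. Qed.

(** * From dimer covers to tilings with few monomers *)

Section TrimmedCovers.
Variables (d : nat) (m : 'I_d -> nat).
Implicit Types (phi : coloring (2 * d) m) (i j : box m).

Definition widen_color (q : 'I_(2 * d)) : 'I_(2 * d).+1 := widen_ord (leqnSn _) q.

Lemma widen_color_neq q : widen_color q != monomer d.
Proof. by rewrite neq_monomer; exact: ltn_ord q. Qed.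

Definition trim phi : coloring (2 * d).+1 m :=
  [ffun i => if [exists j, nbr (widen_color (phi i)) i j] then widen_color (phi i)
             else monomer d].

Lemma dimer_cover_nbr phi i j : phi \in dimer_covers m ->
  nbr (widen_color (phi i)) i j -> widen_color (phi j) = opposite (widen_color (phi i)).
Proof.
rewrite inE => /forallP adm /existsP[k /orP[]/andP[/eqP phik ij]]; apply: val_inj;
  rewrite /= val_opposite phik; have kd := ltn_ord k;
  rewrite [widen_color _ : nat]/= in phik.
  have /forallP/(_ i)/forallP/(_ j) := adm k; rewrite ij /= /Gamma.
  by rewrite phik eqxx kd => /eqP.
have /forallP/(_ j)/forallP/(_ i) := adm k; rewrite ij /= /Gamma.
rewrite ltnNge leq_addl (_ : (k + d < 2 * d)%N) ?addnK/=; last by lia.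
by case: eqP => [//|_]; rewrite phik eqxx.
Qed.

Lemma trim_tiling phi : phi \in dimer_covers m -> trim phi \in tilings m.
Proof.
move=> cov; apply/tilingP => i; rewrite ffunE.
case: ifP => [/existsP[j ij] _|]; last first.
  by rewrite eqxx.
have phij := dimer_cover_nbr cov ij; exists j => //; rewrite ffunE phij.
rewrite nbr_sym in ij; rewrite -phij in ij *.
by case: existsP => // -[]; exists i.
Qed.

Lemma trim_interior phi i : interior_cell i -> trim phi i = widen_color (phi i).
Proof.
move=> int_i; rewrite ffunE; case: existsP => // -[].
exact: interior_nbr int_i (widen_color_neq _).
Qed.

Definition boundary_monomers (psi : coloring (2 * d).+1 m) : bool :=
  [forall i, (psi i == monomer d) ==> ~~ interior_cell i].

(** Trimming preserves the colors of interior cells, so a cover is determined by its trimmed tiling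
    and its boundary colors. *)
Lemma card_trim_fiber psi :
  (#|[pred phi | trim phi == psi]|
     <= (2 * d) ^ #|[pred i : box m | ~~ interior_cell i]|)%N.
Proof.
pose F (i : box m) : pred 'I_(2 * d) :=
  fun q => interior_cell i ==> (widen_color q == psi i).
apply: (@leq_trans #|(family F : pred (coloring (2 * d) m))|).
  apply: subset_leq_card; apply/fintype.subsetP => phi; rewrite !inE => /eqP trimE.
  by apply/forallP => i; apply/implyP => int_i; rewrite -trimE trim_interior.
rewrite card_family foldrE big_map big_enum /= -prod_nat_const.
rewrite [leqRHS]big_mkcond /=; apply: leq_prod => i _; rewrite inE /F.
case: (interior_cell i) => /=; last by rewrite -[leqRHS]card_ord max_card.
apply/card_le1_eqP => q q' /eqP Eq /eqP Eq'.
by apply: val_inj; have /= := congr1 val (etrans Eq (esym Eq')).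
Qed.

Lemma card_dimer_covers_le :
  (#|dimer_covers m| <=
     #|[pred psi in tilings m | boundary_monomers psi]|
     * (2 * d) ^ #|[pred i : box m | ~~ interior_cell i]|)%N.
Proof.
have trimP phi : phi \in dimer_covers m ->
    (trim phi \in tilings m) && boundary_monomers (trim phi).
  move=> cov; rewrite trim_tiling//; apply/forallP => i; apply/implyP => /eqP mono_i.
  apply/negP => /(trim_interior phi); rewrite mono_i => E.
  by have := widen_color_neq (phi i); rewrite -E eqxx.
rewrite -sum1_card (partition_big trim
  (fun psi => (psi \in tilings m) && boundary_monomers psi)) //=.
rewrite -sum_nat_const.
apply: leq_sum => psi _; rewrite sum1_card; apply: leq_trans (card_trim_fiber psi).
by apply: subset_leq_card; apply/fintype.subsetP => phi; rewrite !inE => /andP[].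
Qed.

Lemma tiling_boundary_monomers (psi : coloring (2 * d).+1 m) : psi \in tilings m ->
  boundary_monomers psi ->
  (volume m <= 2 * #|[pred i | (psi i < d)%N]|
     + #|[pred i : box m | ~~ interior_cell i]|)%N.
Proof.
move=> /tiling_balanced <- /forallP bd; rewrite leq_add2l; apply: subset_leq_card.
by apply/fintype.subsetP => i; rewrite !inE => /(implyP (bd i)).
Qed.

(** Trimmed covers have monomers only on the boundary, so the dominant number of dimers is close to
    half the volume. *)
Lemma dominant_dimer_size (R : realType) : ~~ odd (volume m) -> (0 < d)%N ->
  exists s, [/\ (2 * s <= volume m)%N,
    (volume m <= 2 * s + #|[pred i : box m | ~~ interior_cell i]|)%N &
    ln #|dimer_covers m|%:R <= ln (volume m).+1%:R + ln #|tilings_with m s|%:R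
      + #|[pred i : box m | ~~ interior_cell i]|%:R * ln (2 * d%:R) :> R].
Proof.
move=> even_vol d0; set bd := #|_|.
(* Without covers the left-hand side is [ln 0 = 0], and half of the even volume serves as [s]. *)
have [cov0|] := posnP #|dimer_covers m|.
  exists (volume m)./2; rewrite mul2n even_halfK// leqnn leq_addr; split=> //.
  by rewrite cov0 ln0// -natrM !addr_ge0 ?mulr_ge0 ?ln_nat_ge0.
move=> cov0.
pose T s := [pred psi in tilings_with m s | boundary_monomers psi].
have sumT : #|[pred psi in tilings m | boundary_monomers psi]|%:R =
    \sum_(s < (volume m).+1) #|T s|%:R :> R.
  pose size (psi : coloring (2 * d).+1 m) := #|[pred i | (psi i < d)%N]|.
  have lt_size psi : (size psi < (volume m).+1)%N by rewrite ltnS -card_box max_card.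
  rewrite -sum1_card (partition_big (fun psi => Ordinal (lt_size psi)) predT)//=.
  rewrite natr_sum; apply: eq_bigr => s _; rewrite sum1_card; congr _%:R.
  by apply: eq_card => psi; rewrite !inE [LHS]unfold_in /= !inE -val_eqE andbAC.
have [s le_s leT] := exists_ge_average (volume m) (fun s => #|T s|%:R : R).
rewrite -sumT -natrM ler_nat in leT.
have le_cov := leq_trans card_dimer_covers_le (leq_mul leT (leqnn _)).
have T0 : (0 < #|T s|)%N.
  by have := leq_trans cov0 le_cov; rewrite !muln_gt0 => /andP[/andP[]].
have leTN : (#|T s| <= #|tilings_with m s|)%N.
  by apply: subset_leq_card; apply/fintype.subsetP => psi; rewrite !inE => /andP[].
have /card_gt0P[psi] := T0; rewrite !inE => /andP[/andP[til /eqP size_psi] bd_psi].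
exists s; split.
- exact/tilings_with_size/(leq_trans T0).
- by rewrite -size_psi; apply: tiling_boundary_monomers => //; rewrite !inE til.
have d20 : (0 < 2 * d)%N by rewrite muln_gt0.
have tN0 := leq_trans T0 leTN.
rewrite -natrM mulr_natl -lnXn ?ltr0n// -natrX.
rewrite -!lnM ?posrE ?ltr0n ?expn_gt0 ?d20 ?muln_gt0//; last first.
  by rewrite -natrM ltr0n muln_gt0 tN0.
rewrite ler_ln ?posrE -?natrM ?ltr0n ?muln_gt0 ?tN0 ?expn_gt0 ?d20// ler_nat.
by rewrite (leq_trans le_cov)// leq_mul// leq_mul.
Qed.

End TrimmedCovers.

(** * Supporting lines of concave functions *)

Section ConcaveSupport.
Local Open Scope classical_set_scope.
Variables (R : realType) (f : R -> R).
Hypothesis f_concave : @convex_function R R^o `[0, 1]%classic (fun x => - f x).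

Lemma concave_slopes (x p z : R) : 0 <= x -> x < p -> p < z -> z <= 1 ->
  (f z - f p) / (z - p) <= (f p - f x) / (p - x).
Proof.
move=> x0 xp pz z1; have xz : 0 < z - x by lra.
have t01 : (0 : R) <= (z - p) / (z - x) <= 1.
  by rewrite divr_ge0 ?ler_pdivrMr/=; lra.
pose t := Itv01 (proj1 (andP t01)) (proj2 (andP t01)).
have := f_concave t (x := x) (y := z).
rewrite !inE /= !in_itv /= => /(_ _ _)/wrap[]; [lra|lra|].
rewrite !convRE /= /unstable.onem => H.
have E : (z - p) / (z - x) * x + (1 - (z - p) / (z - x)) * z = p by field; lra.
have convE : @conv _ (convex_lmodType R^o) t x z = p.
  exact: etrans (convRE (x : R^o) (z : R^o) t) E.
rewrite convE in H.
have H2 : (z - x) * f p >= (z - p) * f x + (p - x) * f z.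
  have -> : (z - p) * f x + (p - x) * f z =
    (z - x) * - ((z - p) / (z - x) * - f x + (1 - (z - p) / (z - x)) * - f z).
    by field; lra.
  by rewrite ler_pM2l// lerNl.
rewrite ler_pdivlMr ?subr_gt0// mulrAC ler_pdivrMr ?subr_gt0//; lra.
Qed.

(** The slope is the supremum of the chord slopes to the right of [p]; every chord slope to the left
    is an upper bound for them. *)
Lemma concave_support (p : R) : 0 < p < 1 ->
  exists c, forall x, 0 <= x <= 1 -> f x <= f p + c * (x - p).
Proof.
move=> /andP[p0 p1].
pose E := [set (f z - f p) / (z - p) | z in [set z | p < z <= 1]].
have E0 : E !=set0 by exists ((f 1 - f p) / (1 - p)), 1 => //=; rewrite p1 lexx.
have ubE x : 0 <= x -> x < p -> ubound E ((f p - f x) / (p - x)).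
  by move=> x0 xp _ [z /= /andP[pz z1] <-]; exact: concave_slopes.
exists (sup E) => x /andP[x0 x1].
have [xp|px|->] := ltgtP x p; last by rewrite subrr mulr0 addr0.
- have := ge_sup E0 (ubE x x0 xp); rewrite ler_pdivlMr ?subr_gt0//; lra.
- have : (f x - f p) / (x - p) <= sup E.
    apply: ub_le_sup; last by exists x => //=; rewrite px.
    by exists ((f p - f 0) / (p - 0)); apply: ubE.
  rewrite ler_pdivrMr ?subr_gt0//; lra.
Qed.

End ConcaveSupport.

Lemma ln_ge_1BV (R : realType) (x : R) : 0 < x -> 1 - x^-1 <= ln x.
Proof.
move=> x0; have xV0 : 0 < x^-1 by rewrite invr_gt0.
by have := ln_le_subr1 xV0; rewrite lnV ?posrE//; lra.
Qed.

(** * Cubes of even side *)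

Section EvenCubes.
Local Open Scope classical_set_scope.
Variables (R : realType) (d : nat).
Hypothesis d_gt0 : (0 < d)%N.

(** An even side makes the volume even when [d] is positive, so that a cube can have density exactly
    [1]; the successor avoids empty cubes. *)
Definition even_cube (q : nat) : 'I_d -> nat := fun=> (2 * q.+1)%N.

Lemma even_cube_cvg (f : nat -> nat) : (forall q, (q <= f q)%N) ->
  (even_cube \o f) q @[q --> \oo] --> boxes_oo d.
Proof.
move=> le_f P [N PN]; exists N => // q /= Nq; apply: PN => k.
rewrite /= /even_cube (leq_trans Nq)// (leq_trans (le_f q))//.
by rewrite (leq_trans (leqnSn _))// leq_pmull.
Qed.

Lemma volume_even_cube q : volume (even_cube q) = ((2 * q.+1) ^ d)%N.
Proof. by rewrite /volume prod_nat_const card_ord. Qed.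

Lemma volume_even_cube_ge q : (q.+1 <= volume (even_cube q))%N.
Proof.
rewrite volume_even_cube (@leq_trans (2 * q.+1))//; first by lia.
by rewrite -{1}[(2 * q.+1)%N]expn1 leq_pexp2l.
Qed.

Lemma even_volume q : ~~ odd (volume (even_cube q)).
Proof. by rewrite volume_even_cube oddX negb_or -lt0n d_gt0 oddM. Qed.

(** The loss per cell: the first term comes from keeping only one number of dimers, the second from
    the boundary. *)
Definition cube_error (C : R) (q : nat) : R :=
  ln (volume (even_cube q)).+1%:R / (volume (even_cube q))%:R + C / (2 * q.+1)%:R.

(** Since [ln x] is at most twice the square root of [x] and the volume is at least [q + 1], the
    first term is at most [4 / sqrt (q + 1)]. *)
Lemma cube_error_cvg C : cube_error C q @[q --> \oo] --> (0 : R).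
Proof.
have harm : (q.+1%:R^-1 : R) @[q --> \oo] --> (0 : R) by exact: cvg_harmonic.
have sqrt_harm : Num.sqrt (q.+1%:R^-1 : R) @[q --> \oo] --> (0 : R).
  rewrite -[X in _ --> X]sqrtr0.
  by apply: (cvg_comp _ _ harm); exact: (@sqrt_continuous R 0).
have ub : 4 * Num.sqrt (q.+1%:R^-1 : R) @[q --> \oo] --> (0 : R).
  by rewrite -[X in _ --> X](mulr0 4); apply: cvgM => //; exact: cvg_cst.
rewrite -[X in _ --> X]addr0; apply: cvgD; last first.
  rewrite -[X in _ --> X](mulr0 (C / 2)).
  have -> : (fun q => C / (2 * q.+1)%:R) = (fun q => C / 2 * q.+1%:R^-1).
    by apply/funext => q; rewrite natrM invfM mulrA.
  by apply: cvgM => //; exact: cvg_cst.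
apply: (@squeeze_cvgr _ _ _ _ (fun=> 0) (fun q => 4 * Num.sqrt (q.+1%:R^-1))) ub;
  last exact: cvg_cst.
apply: nearW => q; set V := volume _.
have V0 : (0 < V)%N by exact: leq_trans (volume_even_cube_ge q).
have VR0 : 0 < V%:R :> R by rewrite ltr0n.
rewrite divr_ge0 ?ln_nat_ge0//=.
have V1 : 0 < V.+1%:R :> R by [].
set r := Num.sqrt (V.+1%:R : R); have r0 : 0 < r by rewrite sqrtr_gt0.
have rr : r ^+ 2 = V.+1%:R by rewrite sqr_sqrtr.
have lnr : ln (V.+1%:R : R) <= 2 * r.
  by rewrite -rr lnXn// -[ln r *+ 2]mulr_natl ler_pM2l// ltW// ln_sublinear.
set s := Num.sqrt _; have s0 : 0 < s by rewrite sqrtr_gt0.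
have ss : s ^+ 2 = q.+1%:R^-1 by rewrite sqr_sqrtr.
have Vs : 1 <= V%:R * s ^+ 2.
  by rewrite ss ler_pdivlMr// mul1r ler_nat volume_even_cube_ge.
rewrite ler_pdivrMr// (le_trans lnr)//.
have V1V : (V.+1%:R : R) <= 2 * V%:R by rewrite -natrM ler_nat; lia.
have : r ^+ 2 <= (2 * s * V%:R) ^+ 2.
  rewrite rr (le_trans V1V)// !exprMn mulrAC expr2 -!mulrA.
  rewrite (_ : 2 * (2 * _) = 2 * V%:R * (2 * (V%:R * s ^+ 2))); last by ring.
  by rewrite ler_peMr; lra.
have sV0 : 0 <= 2 * s * V%:R by rewrite ltW// mulr_gt0// mulr_gt0.
rewrite ler_sqr ?nnegrE ?(ltW r0)//; lra.
Qed.

End EvenCubes.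

(** * Lower bounds for Hammersley's function *)

Section Hammersley.
Local Open Scope classical_set_scope.
Variables (R : realType) (d : nat) (lambda : R -> R).
Hypothesis d_gt0 : (0 < d)%N.
Hypothesis hlambda : hammersley_function d lambda.

Let D : R := d%:R.

Local Notation cube := (@even_cube d).
Let vol q : R := (volume (cube q))%:R.

Let vol_gt0 q : 0 < vol q.
Proof. by rewrite ltr0n (leq_trans _ (volume_even_cube_ge d_gt0 q)). Qed.

(** The dominant numbers of dimers in even cubes have densities in [[0, 1]]. Along a subsequence
    these converge to some [p], where [hammersley_cvg] applies. *)
Lemma pressure_le_lambda (w theta : R) : 0 < w -> 0 < theta < 1 ->
  exists2 p, 0 <= p <= 1 & bethe_pressure d w theta / 2 <= lambda p + p / 2 * ln w.
Proof.
move=> w0 t01; set F := bethe_pressure _ _ _.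
have [C C0 leC] := interior_sum_ge d w theta.
have sizeP q : exists s, (2 * s <= volume (cube q))%N /\
    F / 2 - cube_error d (C / 2) q <=
      log_density R (cube q) #|tilings_with (cube q) s|
      + (2 * s)%:R / vol q / 2 * ln w.
  have [s [les le]] := dominant_size d_gt0 (cube q) w0 t01.
  exists s; split=> //.
  have := le_trans (leC (cube q) (2 * q.+1)%N isT (fun=> leqnn _)) le.
  rewrite -/F -/(vol q) /log_density /cube_error -/(vol q) [(2 * s)%:R]natrM.
  set n : R := (2 * q.+1)%:R; set L := ln _; set N := ln _ => H.
  have n0 : 0 < n by rewrite ltr0n.
  have v0 := vol_gt0 q.
  rewrite -(ler_pM2l v0).
  have -> : vol q * (F / 2 - (L / vol q + C / 2 / n)) = vol q * (F - C / n) / 2 - L.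
    by field; rewrite !gt_eqF.
  have -> : vol q * (N / vol q + 2%:R * s%:R / vol q / 2 * ln w) = N + s%:R * ln w.
    by field; rewrite !gt_eqF.
  move: H; set X := vol q * _; set K := s%:R * ln w; move: X L N K => X L N K; lra.
have [s sP] := choice sizeP.
pose p q := (2 * s q)%:R / vol q.
have p01 q : 0 <= p q <= 1.
  rewrite /p divr_ge0 ?(ltW (vol_gt0 q))//= ler_pdivrMr// mul1r ler_nat.
  by have [] := sP q.
have bp : bounded_fun p.
  exists 1; split; first exact: num_real.
  move=> M M1 q _ /=; have /andP[pq0 pq1] := p01 q.
  by rewrite ger0_norm// (le_trans pq1)// ltW.
have [f f_incr /cvg_ex[p' pf]] := bolzano_weierstrass bp.
have f_ge q : (q <= f q)%N.
  elim: q => // q IH; apply: leq_ltn_trans IH _.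
  by rewrite ltnNge -[(_ <= _)%N]/(f q.+1 <= f q)%O f_incr ltnn.
have p'01 : 0 <= p' <= 1.
  apply/andP; split.
    by apply: (cvgr_to_ge pf); apply: nearW => q; case/andP: (p01 (f q)).
  by apply: (cvgr_to_le pf); apply: nearW => q; case/andP: (p01 (f q)).
exists p' => //.
have lam := hammersley_cvg hlambda p'01 (@even_cube_cvg d f f_ge)
  (fun q => (sP (f q)).1) pf.
have err : cube_error d (C / 2) (f q) @[q --> \oo] --> (0 : R).
  apply: (cvg_comp _ _ _ (cube_error_cvg d_gt0 (C / 2))).
  move=> P [N _ PN]; exists N => // q /= Nq; apply: PN => /=.
  exact: leq_trans (f_ge q).
have lhs : F / 2 - cube_error d (C / 2) (f q) @[q --> \oo] --> F / 2.
  by rewrite -[X in _ --> X]subr0; apply: cvgB => //; exact: cvg_cst.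
have rhs : log_density R (cube (f q)) #|tilings_with (cube (f q)) (s (f q))|
    + p (f q) / 2 * ln w @[q --> \oo] --> lambda p' + p' / 2 * ln w.
  apply: cvgD; first exact: lam.
  by apply: cvgM; [apply: cvgM; [exact: pf | exact: cvg_cst] | exact: cvg_cst].
apply: (ler_cvg_to lhs rhs).
by apply: nearW => q; exact: (sP (f q)).2.
Qed.

(** The closed form of [bethe_pressure] at [w = 1], for [theta] strictly between [0] and [1]. *)
Definition bethe_entropy (theta : R) : R :=
  - 2 * (1 - theta) * ln (1 - theta) + theta * ln (2 * D / theta)
  + (2 * D - theta) * ln (1 - theta / (2 * D)).

Let D_ge1 : 1 <= D. Proof. by rewrite ler1n. Qed.

Lemma bethe_pressureE (w theta : R) : 0 < w -> 0 < theta < 1 ->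
  bethe_pressure d w theta = bethe_entropy theta + theta * ln w.
Proof.
move=> w0 /andP[t0 t1]; rewrite /bethe_pressure /bethe_term /bethe_entropy natrM -/D.
have D1 := D_ge1; have D0 : 0 < D by lra.
have -> : 2%:R * D * (theta / (2 * D)) = theta by field; rewrite gt_eqF.
have -> : w / (theta / (2 * D)) = 2 * D / theta * w by field; rewrite !gt_eqF.
rewrite lnM ?posrE ?divr_gt0 ?mulr_gt0//.
have -> : 2%:R * D * (1 - theta / (2 * D)) = 2 * D - theta by field; rewrite gt_eqF.
by ring.
Qed.

Lemma lambda_ge_bethe (theta : R) : 0 < theta < 1 ->
  bethe_entropy theta / 2 <= lambda theta.
Proof.
move=> t01; have [c leC] := concave_support (hammersley_concave hlambda) t01.
(* With [ln w = - 2 * c] the term [p / 2 * ln w] cancels the slope of the supporting line, and the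
   unknown [p] disappears. *)
have [p p01] := pressure_le_lambda (expR_gt0 (- 2 * c)) t01.
rewrite bethe_pressureE ?expR_gt0// expRK => le_p.
have := leC p p01; lra.
Qed.

(** At [x = 1 - theta / (2 * D)] the bound [1 - 1 / x] on [ln x] equals
    [- theta / (2 * D - theta)]. *)
Lemma ln_1B_ge (theta : R) : 0 < theta <= 1 ->
  - theta <= (2 * D - theta) * ln (1 - theta / (2 * D)).
Proof.
move=> /andP[t0 t1]; have D1 := D_ge1; have D0 : 0 < D by lra.
have pos : 0 < 2 * D - theta by lra.
have x0 : 0 < 1 - theta / (2 * D).
  by rewrite subr_gt0 ltr_pdivrMr ?mulr_gt0//; lra.
have := ln_ge_1BV x0; rewrite -(ler_pM2l pos).
apply: le_trans; rewrite le_eqVlt; apply/orP; left; apply/eqP.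
by field; rewrite !gt_eqF//; lra.
Qed.

Lemma lambda1_ge_schrijver :
  2^-1 * ((2 * D - 1) * ln (2 * D - 1) - (2 * D - 2) * ln (2 * D)) <= lambda 1.
Proof.
have D1 := D_ge1; have D0 : 0 < D by lra.
(* Half the Bethe entropy without its nonnegative term [- (1 - x) * ln (1 - x)], so that continuity
   at [1] is immediate. *)
pose H (x : R) := (x * (ln (2 * D) - ln x) + (2 * D - x) * ln (1 - x / (2 * D))) / 2.
have -> : 2^-1 * ((2 * D - 1) * ln (2 * D - 1) - (2 * D - 2) * ln (2 * D)) = H 1.
  have pos : 0 < 1 - 1 / (2 * D) by rewrite subr_gt0 ltr_pdivrMr ?mulr_gt0//; lra.
  have -> : ln (2 * D - 1) = ln (1 - 1 / (2 * D)) + ln (2 * D).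
    by rewrite -lnM ?posrE ?mulr_gt0//; congr ln; field; rewrite gt_eqF.
  by rewrite /H ln1; field.
have lam1 : lambda x @[x --> 1^'-] --> lambda 1.
  by have /(continuous_within_itvP _ ltr01)[] := hammersley_continuous hlambda.
have contH : H x @[x --> 1^'-] --> H 1.
  apply: cvg_at_left_filter; apply: cvgM; last exact: cvg_cst.
  apply: cvgD; apply: cvgM.
  - exact: cvg_id.
  - by apply: cvgB; [exact: cvg_cst | exact: continuous_ln].
  - by apply: cvgB; [exact: cvg_cst | exact: cvg_id].
  - apply: (@cvg_comp _ _ _ (fun x => 1 - x / (2 * D)) (@ln R)).
      apply: cvgB; first exact: cvg_cst.
      by apply: cvgM; [exact: cvg_id | exact: cvg_cst].
    by apply: continuous_ln; rewrite subr_gt0 ltr_pdivrMr ?mulr_gt0//; lra.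
apply: (ler_cvg_to contH lam1).
near=> x.
have x1 : x < 1 by near: x; exact: nbhs_left_lt.
have x0 : 0 < x by near: x; exact: nbhs_left_gt.
have x01 : 0 < x < 1 by rewrite x0.
apply: le_trans (lambda_ge_bethe x01); rewrite /H /bethe_entropy.
rewrite ler_pM2r// ln_div ?posrE ?mulr_gt0//.
have : ln (1 - x) <= 0 by rewrite ln_le0//; lra.
have : 0 < 1 - x by lra.
nra.
Unshelve. all: by end_near. Qed.

Lemma lambda_ge (p : R) : 0 <= p <= 1 ->
  2^-1 * (- p * ln p - 2 * (1 - p) * ln (1 - p) + p * ln (2 * D) - p) <= lambda p.
Proof.
move=> p01; have D1 := D_ge1; have D0 : 0 < D by lra.
(* At [p = 0] the bound is [0], as [ln 0] is multiplied by [0]. *)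
have [->|p0] := eqVneq p 0.
  rewrite !(mul0r, oppr0, subr0, ln1, mulr0, addr0).
  by apply: (hammersley_ge0 hlambda); rewrite lexx ler01.
(* At [p = 1] the claim is [(ln (2 * D) - 1) / 2], which is weaker than the Schrijver bound by
   [ln_1B_ge]. *)
have [->|p1] := eqVneq p 1.
  apply: le_trans lambda1_ge_schrijver; rewrite ler_pM2l ?invr_gt0//.
  have := @ln_1B_ge 1; rewrite ltr01 lexx => /(_ isT).
  have -> : 1 - 1 / (2 * D) = (2 * D - 1) / (2 * D) by field; rewrite gt_eqF.
  rewrite ln_div ?posrE ?mulr_gt0//; last by lra.
  rewrite ln1 subrr; lra.
have p01' : 0 < p < 1 by rewrite !lt_neqAle p1 eq_sym p0.
have /andP[pp0 pp1] := p01'.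
apply: le_trans (lambda_ge_bethe p01'); rewrite /bethe_entropy.
have := @ln_1B_ge p; rewrite pp0 ltW// => /(_ isT).
rewrite ln_div ?posrE ?mulr_gt0//; lra.
Qed.

End Hammersley.

(** * Comparison of the entropies with Hammersley's function *)

Lemma card_tilings_with_le_covers (d : nat) (m : 'I_d -> nat) s :
  (#|tilings_with m s| <= #|covers m|)%N.
Proof.
apply: subset_leq_card; apply/fintype.subsetP => phi.
by rewrite inE => /andP[+ _]; rewrite inE => /andP[].
Qed.

(** When the dimers fill the volume there is no monomer, so the coloring already takes its values in
    the [2 * d] dimer colors. *)
Lemma card_tilings_with_half_le (d : nat) (m : 'I_d -> nat) s :
  (2 * s)%N = volume m -> (#|tilings_with m s| <= #|dimer_covers m|)%N.
Proof.
move=> sE; pose widen (phi : coloring (2 * d) m) : coloring (2 * d).+1 m :=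
  [ffun i => widen_color (phi i)].
apply: leq_trans (leq_image_card widen (mem (dimer_covers m))).
apply: subset_leq_card; apply/fintype.subsetP => psi.
rewrite inE => /andP[til /eqP size_psi].
have mono0 : #|[pred i | psi i == monomer d]| = 0%N.
  by have := tiling_balanced til; rewrite size_psi; lia.
have lt_psi i : (psi i < 2 * d)%N.
  rewrite -neq_monomer; apply/negP => psii.
  by have := card0_eq mono0 i; rewrite inE psii.
apply/fintype.imageP; exists [ffun i => Ordinal (lt_psi i)].
  have : psi \in covers m by move: til; rewrite inE => /andP[].
  rewrite !inE => /forallP adm.
  apply/forallP => k; apply/forallP => i; apply/forallP => j.
  have /forallP/(_ i)/forallP/(_ j)/implyP := adm k.
  by rewrite /Gamma !ffunE => H; apply/implyP => /H.
by apply/ffunP => i; rewrite !ffunE; apply: val_inj.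
Qed.

Section Entropies.
Local Open Scope classical_set_scope.
Variables (R : realType) (d : nat) (lambda : R -> R).
Hypothesis d_gt0 : (0 < d)%N.
Hypothesis hlambda : hammersley_function d lambda.
Local Notation cube := (@even_cube d).

Let vol q : R := (volume (cube q))%:R.

Let vol_gt0 q : 0 < vol q.
Proof. by rewrite ltr0n (leq_trans _ (volume_even_cube_ge d_gt0 q)). Qed.

Let cube_cvg : cube q @[q --> \oo] --> boxes_oo d.
Proof. exact: (@even_cube_cvg d id (fun=> leqnn _)). Qed.

Lemma entropy_ge_lambda (h p : R) : monomer_dimer_entropy d h -> 0 <= p <= 1 ->
  lambda p <= h.
Proof.
move=> hh p01; have /andP[p0 p1] := p01.
(* Rounding down keeps [2 * s q] within [2] of [p * vol q], so the densities converge to [p]. *)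
pose s q := Num.Def.trunc (p * vol q / 2).
have pv0 q : 0 <= p * vol q / 2 by rewrite divr_ge0// mulr_ge0// ltW.
have sP q : (s q)%:R <= p * vol q / 2 < (s q)%:R + 1.
  by rewrite natr1; apply: truncn_itv.
have le_s q : (2 * s q <= volume (cube q))%N.
  rewrite -(ler_nat R) natrM -/(vol q).
  have /andP[le_s _] := sP q; have := vol_gt0 q.
  have : p * vol q <= vol q by rewrite ler_piMl// ltW.
  lra.
have s_cvg : (2 * s q)%:R / vol q @[q --> \oo] --> p.
  have lower : p - 2 * q.+1%:R^-1 @[q --> \oo] --> p.
    rewrite -[X in _ --> X]subr0; apply: cvgB; first exact: cvg_cst.
    rewrite -[X in _ --> X](mulr0 2).
    by apply: cvgM; [exact: cvg_cst | exact: cvg_harmonic].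
  apply: (@squeeze_cvgr _ _ _ _ _ (fun=> p) _ _ _ lower (cvg_cst p)); apply: nearW => q.
  have /andP[le_sq lt_sq] := sP q; have v0 := vol_gt0 q; apply/andP; split; last first.
    by rewrite ler_pdivrMr// natrM; lra.
  rewrite ler_pdivlMr// natrM mulrBl.
  have : 1 <= q.+1%:R^-1 * vol q.
    by rewrite mulrC ler_pdivlMr// mul1r ler_nat volume_even_cube_ge.
  rewrite -[2 * _ * vol q]mulrA; set X := _ * vol q; set Y := p * vol q in lt_sq *.
  by move=> X1; lra.
have lam := hammersley_cvg hlambda p01 cube_cvg le_s s_cvg.
have cov : log_density R (cube q) #|covers (cube q)| @[q --> \oo] --> h.
  exact: (cvg_comp _ _ cube_cvg hh).
apply: (ler_cvg_to lam cov); apply: nearW => q.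
rewrite /log_density ler_pM2r ?invr_gt0 ?vol_gt0//.
have [->|] := posnP #|tilings_with (cube q) (s q)|; first by rewrite ln0// ln_nat_ge0.
move=> N0; rewrite ler_ln ?posrE ?ltr0n ?ler_nat ?card_tilings_with_le_covers//.
exact: leq_trans N0 (card_tilings_with_le_covers _ _).
Qed.

(** Along even cubes, trimming gives the upper bound with densities tending to [1], and tilings
    without monomers give the lower bound. *)
Lemma dimer_entropy_lambda1 (ht : R) : dimer_entropy d ht -> ht = lambda 1.
Proof.
move=> hht; have i01 : 0 <= (1 : R) <= 1 by rewrite ler01 lexx.
have cov : log_density R (cube q) #|dimer_covers (cube q)| @[q --> \oo] --> ht.
  exact: (cvg_comp _ _ cube_cvg hht).
apply/eqP; rewrite eq_le; apply/andP; split.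
- have sizeP q := @dominant_dimer_size d (cube q) R (even_volume d_gt0 q) d_gt0.
  have [s sP] := choice sizeP.
  have le_s q : (2 * s q <= volume (cube q))%N by have [] := sP q.
  pose C : R := 2 * d%:R.
  have C0 : 0 <= C by rewrite mulr_ge0.
  have bdP q : #|[pred i : box (cube q) | ~~ interior_cell i]|%:R
      <= C / (2 * q.+1)%:R * vol q.
    rewrite mulrAC ler_pdivlMr ?ltr0n// /C -!natrM ler_nat.
    exact: card_boundary_le.
  have err_cvg := cube_error_cvg d_gt0 C.
  have err_ge0 q : 0 <= ln (volume (cube q)).+1%:R / (volume (cube q))%:R :> R.
    by rewrite divr_ge0 ?ln_nat_ge0.
  have s_cvg : (2 * s q)%:R / vol q @[q --> \oo] --> (1 : R).
    have lower : 1 - cube_error d C q @[q --> \oo] --> (1 : R).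
      by rewrite -[X in _ --> X]subr0; apply: cvgB => //; exact: cvg_cst.
    apply: (@squeeze_cvgr _ _ _ _ _ (fun=> 1) _ _ _ lower (cvg_cst (1 : R))).
    apply: nearW => q.
    have v0 := vol_gt0 q; apply/andP; split; last first.
      by rewrite ler_pdivrMr// mul1r ler_nat.
    have [_ + _] := sP q; rewrite -(ler_nat R) natrD -/(vol q) => le_v.
    have bd := bdP q; have a0 := err_ge0 q; rewrite /cube_error -/(vol q) in a0 *.
    set b := C / _ in bd *; set a := ln _ / _ in a0 *.
    rewrite ler_pdivlMr// mulrBl mulrDl.
    have : 0 <= a * vol q by rewrite mulr_ge0// ltW.
    lra.
  have lam := hammersley_cvg hlambda i01 cube_cvg le_s s_cvg.
  pose L : R := ln (2 * d%:R).
  have L0 : 0 <= L by rewrite /L -natrM ln_nat_ge0.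
  (* The factor [1 + L] absorbs both the loss from choosing one [s] and the cost [L] of each
     boundary cell. *)
  have upper : log_density R (cube q) #|tilings_with (cube q) (s q)|
      + (1 + L) * cube_error d C q @[q --> \oo] --> lambda 1.
    rewrite -[X in _ --> X]addr0; apply: cvgD => //.
    by rewrite -[X in _ --> X](mulr0 (1 + L)); apply: cvgM => //; exact: cvg_cst.
  apply: (ler_cvg_to cov upper); apply: nearW => q.
  have v0 := vol_gt0 q; have a0 := err_ge0 q; have [_ _ le_ln] := sP q.
  have bd := ler_wpM2r L0 (bdP q).
  rewrite /log_density /cube_error -/(vol q) ler_pdivrMr//.
  rewrite -/(vol q) in a0; set N := ln #|tilings_with _ _|%:R in le_ln *.
  set M := ln (volume _).+1%:R in le_ln a0 *.
  set b := C / _ in bd *.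
  have b0 : 0 <= b by rewrite /b divr_ge0.
  have -> : (N / vol q + (1 + L) * (M / vol q + b)) * vol q =
      N + M + L * b * vol q + (L * (M / vol q) + b) * vol q.
    by field; rewrite gt_eqF.
  have : 0 <= (L * (M / vol q) + b) * vol q.
    by rewrite mulr_ge0 ?(ltW v0)// addr_ge0// mulr_ge0.
  rewrite -/L in le_ln; lra.
- have le_s q : (2 * (volume (cube q))./2 <= volume (cube q))%N.
    by rewrite mul2n even_halfK// even_volume.
  have sE q : (2 * (volume (cube q))./2)%N = volume (cube q).
    by rewrite mul2n even_halfK// even_volume.
  have s_cvg : (2 * (volume (cube q))./2)%:R / vol q @[q --> \oo] --> (1 : R).
    have -> : (fun q => (2 * (volume (cube q))./2)%:R / vol q) = fun=> 1.
      by apply/funext => q; rewrite sE divff// gt_eqF// vol_gt0.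
    exact: cvg_cst.
  have lam := hammersley_cvg hlambda i01 cube_cvg le_s s_cvg.
  apply: (ler_cvg_to lam cov); apply: nearW => q.
  rewrite /log_density ler_pM2r ?invr_gt0 ?vol_gt0//.
  have le_card := card_tilings_with_half_le (sE q).
  have [->|N0] := posnP #|tilings_with (cube q) (volume (cube q))./2|.
    by rewrite ln0// ln_nat_ge0.
  by rewrite ler_ln ?posrE ?ltr0n ?ler_nat// (leq_trans N0).
Qed.

End Entropies.

Theorem theorem5p2 (R : realType) (d : nat) (p : R)
    (lambda : R -> R) (h ht : R)
    (hd : (0 < d)%N) (hp : 0 <= p <= 1)
    (hlambda : hammersley_function d lambda)
    (hh : monomer_dimer_entropy d h)
    (hht : dimer_entropy d ht) :
  let D : R := d%:R in
  let pd : R := (4 * D + 1 - Num.sqrt (8 * D + 1)) / (4 * D) in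
  [/\ lambda p >=
        2^-1 * (- p * ln p - 2 * (1 - p) * ln (1 - p) + p * ln (2 * D) - p),
      ht = lambda 1,
      lambda 1 >=
        2^-1 * ((2 * D - 1) * ln (2 * D - 1) - (2 * D - 2) * ln (2 * D)) &
      h >=
        2^-1 * (- pd * ln pd - 2 * (1 - pd) * ln (1 - pd)
                + pd * ln (2 * D) - pd)].
Proof.
move=> D pd; split.
- exact: (lambda_ge hd hlambda hp).
- exact: (dimer_entropy_lambda1 hd hlambda hht).
- exact: (lambda1_ge_schrijver hd hlambda).
(* [pd] is a root of [2 * D * (1 - p) ^ 2 = p], where the derivative of the bound in [lambda_ge]
   vanishes. It lies in [[0, 1]] because [1 <= sqrt (8 * D + 1) <= 4 * D + 1]. *)
have D1 : 1 <= D by rewrite ler1n.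
have sqrt1 : 1 <= Num.sqrt (8 * D + 1).
  by rewrite -[leLHS]sqrtr1 ler_sqrt; lra.
have sqrt2 : Num.sqrt (8 * D + 1) <= 4 * D + 1.
  have -> : 4 * D + 1 = Num.sqrt ((4 * D + 1) ^+ 2).
    by rewrite sqrtr_sqr ger0_norm//; lra.
  have sq0 : 0 <= D ^+ 2 by rewrite exprn_ge0//; lra.
  rewrite ler_sqrt ?exprn_ge0//; lra.
have pd01 : 0 <= pd <= 1.
  by rewrite /pd divr_ge0 ?ler_pdivrMr ?mulr_gt0//; lra.
exact: le_trans (lambda_ge hd hlambda pd01) (entropy_ge_lambda hd hlambda hh pd01).
Qed.
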